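(* Let $R$ be a commutative Noetherian ring with non-zero identity, $\mathfrak a$ an ideal of $R$, and $\mathcal S$ a Serre subcategory of the category of $R$-modules. Let $X$ be an arbitrary $R$-module and $n$ a non-negative integer. Then the following statements are equivalent: (i) $H^i_{\mathfrak a}(X)$ is in $\mathcal S$ for all $i\le n$. (ii) $H^i_{\mathfrak a}(M,X)$ is in $\mathcal S$ for every finitely generated $R$-module $M$ and for all $i\le n$. The same equivalence holds with ''for all $i\le n$'' replaced by ''for all $i$'' in both (i) and (ii).
   Context: $H^i_{\mathfrak a}(M,X)=\varinjlim_{k}\operatorname{Ext}^i_R(M/\mathfrak a^kM,X)$ is the $i$-th generalized local cohomology module, and $H^i_{\mathfrak a}(X)=H^i_{\mathfrak a}(R,X)$ is ordinary local cohomology. A Serre subcategory $\mathcal S$ of the category of $R$-modules is a (nonempty) class of $R$-modules such that for every short exact sequence $0\to X'\to X\to X''\to 0$, $X\in\mathcal S$ if and only if $X',X''\in\mathcal S$. *)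

(* Defs.v *)
From HB Require Import structures.
From mathcomp Require Import all_boot all_algebra.
From mathcomp Require Import generic_quotient ring_quotient.
From mathcomp Require Import boolp classical_sets functions.
From mathcomp.multinomials Require Import freeg.

Set Implicit Arguments.
Unset Strict Implicit.
Unset Printing Implicit Defensive.

Import GRing.Theory.
Local Open Scope ring_scope.
Local Open Scope quotient_scope.

(* The library's [submodClosed] structure does not record closure under
   opposite, which quotients require, so submodules are packed here. *)
Record submodule (R : comNzRingType) (V : lmodType R) := Submodule {
  submod_pred :> {pred V};
  submodP : submod_closed submod_pred
}.

HB.instance Definition _ (R : comNzRingType) (V : lmodType R)
    (U : submodule V) :=
  GRing.isSubmodClosed.Build R V (submod_pred U)
    (GRing.submod_closed_semi (submodP U)).

Section Submodules.
Variables (R : comNzRingType) (V : lmodType R).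

Fact full_subproof : submod_closed (fun _ : V => true).
Proof. by []. Qed.
Definition full : submodule V := Submodule full_subproof.

Definition span_pred (A : set V) : {pred V} := fun x =>
  `[< exists2 s : seq (R * V), {in s, forall p, A p.2} &
        x = \sum_(p <- s) p.1 *: p.2 >].

Fact span_subproof A : submod_closed (span_pred A).
Proof.
split; first by apply/asboolP; exists [::]; rewrite ?big_nil.
move=> r x y /asboolP[s sA ->] /asboolP[t tA ->]; apply/asboolP.
exists ([seq (r * p.1, p.2) | p <- s] ++ t).
  by move=> p; rewrite mem_cat => /orP[/mapP[q /sA Aq ->]|/tA].
rewrite big_cat big_map scaler_sumr; congr (_ + _).
by apply: eq_bigr => p _; rewrite scalerA.
Qed.
Definition span (A : set V) : submodule V := Submodule (span_subproof A).

Lemma mem_span (A : set V) x : A x -> x \in span A.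
Proof.
move=> Ax; apply/asboolP; exists [:: (1, x)]; last by rewrite big_seq1 scale1r.
by move=> p; rewrite inE => /eqP ->.
Qed.

Lemma span_sub (A : set V) (U : submodule V) :
  (forall x, A x -> x \in U) -> {subset span A <= U}.
Proof.
move=> AU x /asboolP[s sA ->]; rewrite big_seq; apply: rpred_sum => p /sA Ap.
exact/rpredZ/AU.
Qed.

Lemma span_set0 x : x \in span set0 -> x = 0.
Proof. by case/asboolP => s sP ->; rewrite big_seq big1 // => p /sP. Qed.

End Submodules.
Arguments full {R} V.

Section SubmoduleType.
Variables (R : comNzRingType) (V : lmodType R) (U : submodule V).

Record subm := Subm { subm_val : V; _ : subm_val \in U }.

HB.instance Definition _ := [isSub for subm_val].
HB.instance Definition _ := [Choice of subm by <:].
HB.instance Definition _ := [SubChoice_isSubZmodule of subm by <:].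
HB.instance Definition _ := [SubZmodule_isSubLmodule of subm by <:].

End SubmoduleType.

Definition quomod (R : comNzRingType) (V : lmodType R) (U : submodule V) :=
  Quotient.quot U.

Section QuotientModule.
Variables (R : comNzRingType) (V : lmodType R) (U : submodule V).

HB.instance Definition _ := GRing.Zmodule.on (quomod U).

Definition quo_in (x : V) : quomod U := \pi_(Quotient.quot U) x.

Lemma quo_inK : cancel (repr : Quotient.quot U -> V) quo_in.
Proof. exact: reprK. Qed.

Lemma quo_in_eq x y : (quo_in x = quo_in y) <-> (x - y \in U).
Proof.
by rewrite Quotient.idealrBE; split=> [|/eqP]; [move=> e; apply/eqP|].
Qed.

Lemma quo_inD : {morph quo_in : x y / x + y}.
Proof. exact: Quotient.pi_add. Qed.

Lemma quo_in_eq0 x : quo_in x = 0 <-> x \in U.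
Proof.
have <- : quo_in 0 = 0 by apply: (addrI (quo_in 0)); rewrite -quo_inD !addr0.
by rewrite quo_in_eq subr0.
Qed.

Definition quo_scale (r : R) (x : quomod U) :=
  quo_in (r *: repr (x : Quotient.quot U)).

Lemma quo_scaleE r x : quo_scale r (quo_in x) = quo_in (r *: x).
Proof.
apply/quo_in_eq; rewrite -scalerBr rpredZ //; apply/quo_in_eq.
exact: quo_inK.
Qed.

Fact quo_scaleA r s x : quo_scale r (quo_scale s x) = quo_scale (r * s) x.
Proof. by rewrite -[x]quo_inK !quo_scaleE scalerA. Qed.

Fact quo_scale1 : left_id 1 quo_scale.
Proof. by move=> x; rewrite -[x]quo_inK !quo_scaleE scale1r. Qed.

Fact quo_scaleDr : right_distributive quo_scale +%R.
Proof.
move=> r x y; rewrite -[x]quo_inK -[y]quo_inK -quo_inD !quo_scaleE.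
by rewrite scalerDr quo_inD.
Qed.

Fact quo_scaleDl x : {morph quo_scale^~ x : r s / r + s}.
Proof.
by move=> r s; rewrite -[x]quo_inK !quo_scaleE scalerDl quo_inD.
Qed.

HB.instance Definition _ := GRing.Zmodule_isLmodule.Build R (quomod U)
  quo_scaleA quo_scale1 quo_scaleDr quo_scaleDl.

Fact quo_in_linear : linear quo_in.
Proof. by move=> r x y; rewrite quo_inD -quo_scaleE. Qed.
HB.instance Definition _ := GRing.isLinear.Build R V (quomod U) *:%R quo_in
  quo_in_linear.

End QuotientModule.

Section Maps.
Variables (R : comNzRingType) (V W : lmodType R).

Fact kermod_subproof (f : {linear V -> W}) :
  submod_closed (fun x => f x == 0).
Proof.
split; first by rewrite unfold_in linear0.
by move=> r x y /eqP fx /eqP fy; rewrite unfold_in linearP fx fy scaler0 addr0.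
Qed.
Definition kermod (f : {linear V -> W}) : submodule V :=
  Submodule (kermod_subproof f).

Fact immod_subproof (f : {linear V -> W}) :
  submod_closed (fun y => `[< exists x, f x = y >]).
Proof.
split; first by apply/asboolP; exists 0; rewrite linear0.
move=> r x y /asboolP[u <-] /asboolP[v <-]; apply/asboolP.
by exists (r *: u + v); rewrite linearP.
Qed.
Definition immod (f : {linear V -> W}) : submodule W :=
  Submodule (immod_subproof f).

Fact premod_subproof (f : {linear V -> W}) (U : submodule W) :
  submod_closed (fun x => f x \in U).
Proof.
split; first by rewrite unfold_in linear0 rpred0.
by move=> r x y fx fy; rewrite unfold_in linearP rpredD ?rpredZ.
Qed.
Definition premod (f : {linear V -> W}) (U : submodule W) : submodule V :=
  Submodule (premod_subproof f U).

Section SubMap.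
Variables (f : {linear V -> W}) (A : submodule V) (B : submodule W).
Hypothesis fAB : forall x, x \in A -> f x \in B.

Definition sub_map (x : subm A) : subm B := Subm (fAB (valP x)).

Fact sub_map_linear : linear sub_map.
Proof. by move=> r x y; apply: val_inj; rewrite /= linearP. Qed.
HB.instance Definition _ := GRing.isLinear.Build R (subm A) (subm B) *:%R
  sub_map sub_map_linear.

Definition quo_fun (x : quomod A) : quomod B :=
  quo_in B (f (repr (x : Quotient.quot A))).

Lemma quo_funE x : quo_fun (quo_in A x) = quo_in B (f x).
Proof.
apply/quo_in_eq; rewrite -linearB; apply: fAB; apply/quo_in_eq.
exact: quo_inK.
Qed.

Fact quo_fun_linear : linear quo_fun.
Proof.
move=> r x y; rewrite -[x]quo_inK -[y]quo_inK -linearP !quo_funE.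
by rewrite !linearP.
Qed.

Definition quo_map : {linear quomod A -> quomod B} :=
  HB.pack quo_fun (GRing.isLinear.Build R (quomod A) (quomod B) *:%R
    quo_fun quo_fun_linear).

Lemma quo_mapE x : quo_map (quo_in A x) = quo_in B (f x).
Proof. exact: quo_funE. Qed.

End SubMap.

Fact linears_subproof : submod_closed (fun f : V -> W => `[< linear f >]).
Proof.
split; first by apply/asboolP => r x y; rewrite /= scaler0 addr0.
move=> a f g /asboolP fl /asboolP gl; apply/asboolP => r x y.
by rewrite !fctE fl gl !scalerDr !scalerA [a * r]mulrC addrACA.
Qed.
Definition linears : submodule (V -> W) := Submodule linears_subproof.

Definition hom : lmodType R := subm linears.

Definition hom_app (f : hom) : V -> W := subm_val f.

Fact hom_app_linear (f : hom) : linear (hom_app f).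
Proof. exact/asboolP/(valP f). Qed.
HB.instance Definition _ (f : hom) := GRing.isLinear.Build R V W *:%R
  (hom_app f) (hom_app_linear f).

Lemma hom_ext (f g : hom) : hom_app f =1 hom_app g -> f = g.
Proof. by move=> fg; apply/val_inj/funext. Qed.

End Maps.

Section Precomposition.
Variables (R : comNzRingType) (U V X : lmodType R) (g : {linear U -> V}).

Fact precomp_subproof (phi : hom V X) :
  (fun x => hom_app phi (g x)) \in linears U X.
Proof. by apply/asboolP => r x y; rewrite !linearP. Qed.

Definition precomp (phi : hom V X) : hom U X := Subm (precomp_subproof phi).

Fact precomp_linear : linear precomp.
Proof. by move=> r x y; apply: hom_ext. Qed.
HB.instance Definition _ := GRing.isLinear.Build R (hom V X) (hom U X) *:%R
  precomp precomp_linear.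

End Precomposition.
Arguments precomp {R U V} X g.

Section Free.
Variable R : comNzRingType.

Definition free_mod (T : choiceType) : lmodType R := {freeg T / R}.

Definition free_lift (T : choiceType) (V : lmodType R) (g : T -> V) :
  free_mod T -> V := fglift g.

Fact free_lift_linear (T : choiceType) (V : lmodType R) (g : T -> V) :
  linear (free_lift g).
Proof.
have liftB x y : free_lift g (x - y) = free_lift g x - free_lift g y.
  exact: lift_is_additive.
have lift0 : free_lift g 0 = 0 by rewrite -(subrr 0) liftB subrr.
have liftD x y : free_lift g (x + y) = free_lift g x + free_lift g y.
  by rewrite -{1}[y]opprK liftB -[- y]sub0r liftB lift0 sub0r opprK.
have lift_sum (s : seq T) (h : T -> free_mod T) :
    free_lift g (\sum_(x <- s) h x) = \sum_(x <- s) free_lift g (h x).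
  exact: (big_morph _ liftD lift0).
move=> r x y; rewrite liftD; congr (_ + _).
rewrite -[in RHS](freeg_sumE x) [r *: x]/(fgscale r x) /fgscale !lift_sum.
rewrite scaler_sumr; apply: eq_bigr => k _.
by rewrite /free_lift !liftU scalerA.
Qed.
HB.instance Definition _ (T : choiceType) (V : lmodType R) (g : T -> V) :=
  GRing.isLinear.Build R (free_mod T) V *:%R (free_lift g) (free_lift_linear g).

Lemma free_liftU (T : choiceType) (V : lmodType R) (g : T -> V) x :
  free_lift g << x >> = g x.
Proof. by rewrite /free_lift liftU scale1r. Qed.

Lemma free_ext (T : choiceType) (V : lmodType R) (f g : {linear free_mod T -> V}) :
  (forall x : T, f << x >> = g << x >>) -> f =1 g.
Proof.
move=> fg x; rewrite -(freeg_sumE x).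
rewrite (raddf_sum f) (raddf_sum g); apply: eq_bigr => k _.
have -> : << coeff k x *g k >> = coeff k x *: (<< k >> : free_mod T) :> free_mod T.
  apply/eqP/freeg_eqP => y.
  by rewrite [RHS]coeffZ !coeffU mul1r.
by apply: (etrans (linearZ_LR f _ _)); rewrite fg; apply/esym/linearZ_LR.
Qed.

Definition free_map (T T' : choiceType) (g : T -> T') : free_mod T -> free_mod T' :=
  free_lift (fun x => << g x >> : free_mod T').

HB.instance Definition _ (T T' : choiceType) (g : T -> T') :=
  GRing.Linear.on (free_map g).

Definition free_eps (V : lmodType R) : free_mod V -> V := free_lift idfun.
HB.instance Definition _ (V : lmodType R) := GRing.Linear.on (@free_eps V).

Lemma free_eps_map (V W : lmodType R) (f : {linear V -> W}) x :
  free_eps (free_map f x) = f (free_eps x).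
Proof.
pose h1 : {linear free_mod V -> W} := @free_eps W \o free_map f.
pose h2 : {linear free_mod V -> W} := f \o @free_eps V.
suff : h1 =1 h2 by apply.
by apply: free_ext => y; rewrite /= /free_map /free_eps !free_liftU.
Qed.

Definition omega (V : lmodType R) : lmodType R := subm (kermod (@free_eps V)).

Fact omega_map_subproof (V W : lmodType R) (f : {linear V -> W}) x :
  x \in kermod (@free_eps V) -> free_map f x \in kermod (@free_eps W).
Proof.
by move=> /eqP x0; rewrite unfold_in /= free_eps_map x0 linear0.
Qed.

Definition omega_map (V W : lmodType R) (f : {linear V -> W}) :
  {linear omega V -> omega W} := sub_map (omega_map_subproof f).

Fixpoint syz (M : lmodType R) (i : nat) : lmodType R :=
  if i is j.+1 then omega (syz M j) else M.

Fixpoint syz_map (M N : lmodType R) (f : {linear M -> N}) (i : nat) :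
    {linear syz M i -> syz N i} :=
  if i is j.+1 then omega_map (syz_map f j) else f.

(* The canonical free resolution
     ... -> free_mod (syz M 2) -> free_mod (syz M 1) -> free_mod M -> M -> 0. *)
Definition res (M : lmodType R) (i : nat) : lmodType R := free_mod (syz M i).

Definition res_d (M : lmodType R) (i : nat) : {linear res M i.+1 -> res M i} :=
  val \o @free_eps (syz M i.+1).

Definition res_map (M N : lmodType R) (f : {linear M -> N}) (i : nat) :
  {linear res M i -> res N i} := free_map (syz_map f i).

Lemma free_eps_surj (V : lmodType R) (x : V) : exists y, free_eps y = x.
Proof. by exists << x >>; rewrite /free_eps free_liftU. Qed.

Lemma res_exact0 (M : lmodType R) (x : res M 0) :
  @free_eps M x = 0 <-> exists y, res_d M 0 y = x.
Proof.
split=> [x0|[y <-]]; last exact/eqP/(valP (free_eps y)).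
have xK : x \in kermod (@free_eps M) by apply/eqP.
have [y yx] := free_eps_surj (Subm xK : omega M).
by exists y; rewrite /res_d /= yx.
Qed.

Lemma res_exact (M : lmodType R) i (x : res M i.+1) :
  res_d M i x = 0 <-> exists y, res_d M i.+1 y = x.
Proof.
rewrite -(res_exact0 (M := syz M i.+1) x).
by split=> [x0|/= ->]; [apply: val_inj|].
Qed.

Lemma res_map_d (M N : lmodType R) (f : {linear M -> N}) i x :
  res_map f i (res_d M i x) = res_d N i (res_map f i.+1 x).
Proof. by rewrite /res_d /= free_eps_map. Qed.

End Free.

Section Ext.
Variables (R : comNzRingType) (M X : lmodType R).

Definition cocycles (i : nat) : submodule (hom (res M i) X) :=
  kermod (precomp X (res_d M i)).

Definition coboundaries (i : nat) : submodule (hom (res M i) X) :=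
  if i is j.+1 then immod (precomp X (res_d M j)) else span set0.

(* Ext^i(M, X) = H^i(Hom(P, X)) for the free resolution P = res M of M. *)
Definition ext (i : nat) : lmodType R :=
  quomod (premod (val : subm (cocycles i) -> _) (coboundaries i)).

End Ext.

Lemma coboundaries_sub (R : comNzRingType) (M X : lmodType R) i :
  {subset coboundaries M X i <= cocycles M X i}.
Proof.
case: i => [|i] phi; first by apply: span_sub.
move=> /asboolP[psi <-]; apply/eqP/hom_ext => x /=.
have /res_exact dd0 : exists y, res_d M i.+1 y = res_d M i.+1 x by exists x.
exact: etrans (congr1 (hom_app psi) dd0) (linear0 (hom_app psi)).
Qed.

Section ExtMap.
Variables (R : comNzRingType) (M N X : lmodType R) (f : {linear M -> N}).
Variable i : nat.

Fact cocycles_map_subproof phi :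
  phi \in cocycles N X i -> precomp X (res_map f i) phi \in cocycles M X i.
Proof.
move=> /eqP phi0; apply/eqP/hom_ext => x /=.
rewrite res_map_d.
by have /= -> := congr1 (fun h => hom_app h (res_map f i.+1 x)) phi0.
Qed.

Fact ext_map_subproof z :
    z \in premod (val : subm (cocycles N X i) -> _) (coboundaries N X i) ->
  sub_map cocycles_map_subproof z
    \in premod (val : subm (cocycles M X i) -> _) (coboundaries M X i).
Proof.
case: z => phi phiZ; rewrite !unfold_in /= => phiB.
case: i phi phiZ phiB => [|j] phi phiZ phiB.
  have -> : phi = 0 by exact: span_set0.
  by rewrite linear0; exact: (rpred0 (coboundaries M X 0)).
case/asboolP: phiB => psi <-; apply/asboolP; exists (precomp X (res_map f j) psi).
by apply/hom_ext => x /=; rewrite res_map_d.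
Qed.

(* Ext^i(-, X) is contravariant. *)
Definition ext_map : {linear ext N X i -> ext M X i} :=
  quo_map ext_map_subproof.

End ExtMap.

Section SequentialColimit.
Variables (R : comNzRingType) (A : nat -> lmodType R).

Definition dprod := forall k, A k.

HB.instance Definition _ := gen_eqMixin dprod.
HB.instance Definition _ := gen_choiceMixin dprod.

Let add (x y : dprod) : dprod := fun k => x k + y k.
Let opp (x : dprod) : dprod := fun k => - x k.
Let zero : dprod := fun k => 0.
Let scale (r : R) (x : dprod) : dprod := fun k => r *: x k.

Fact dprod_addA : associative add.
Proof. by move=> x y z; apply: functional_extensionality_dep => k; exact: addrA. Qed.
Fact dprod_addC : commutative add.
Proof. by move=> x y; apply: functional_extensionality_dep => k; exact: addrC. Qed.
Fact dprod_add0 : left_id zero add.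
Proof. by move=> x; apply: functional_extensionality_dep => k; exact: add0r. Qed.
Fact dprod_addN : left_inverse zero opp add.
Proof. by move=> x; apply: functional_extensionality_dep => k; exact: addNr. Qed.
HB.instance Definition _ := GRing.isZmodule.Build dprod
  dprod_addA dprod_addC dprod_add0 dprod_addN.

Fact dprod_scaleA r s x : scale r (scale s x) = scale (r * s) x.
Proof. by apply: functional_extensionality_dep => k; exact: scalerA. Qed.
Fact dprod_scale1 : left_id 1 scale.
Proof. by move=> x; apply: functional_extensionality_dep => k; exact: scale1r. Qed.
Fact dprod_scaleDr : right_distributive scale +%R.
Proof. by move=> r x y; apply: functional_extensionality_dep => k; exact: scalerDr. Qed.
Fact dprod_scaleDl x : {morph scale^~ x : r s / r + s}.
Proof. by move=> r s; apply: functional_extensionality_dep => k; exact: scalerDl. Qed.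
HB.instance Definition _ := GRing.Zmodule_isLmodule.Build R dprod
  dprod_scaleA dprod_scale1 dprod_scaleDr dprod_scaleDl.

Fact finsupp_subproof :
  submod_closed (fun x : dprod => `[< exists n, forall k, (n <= k)%N -> x k = 0 >]).
Proof.
split; first by apply/asboolP; exists 0%N.
move=> r x y /asboolP[m xm] /asboolP[n yn]; apply/asboolP.
exists (maxn m n) => k; rewrite geq_max => /andP[mk nk].
have -> : (r *: x + y) k = r *: x k + y k by [].
by rewrite xm // yn // scaler0 addr0.
Qed.
Definition dsum : lmodType R := subm (Submodule finsupp_subproof).

Definition single k (x : A k) : dprod := dfwith (fun l => 0 : A l) x.

Lemma single_in k (x : A k) : single x k = x.
Proof. exact: dfwith_in. Qed.

Lemma single_out k (x : A k) l : k != l -> single x l = 0.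
Proof. exact: dfwith_out. Qed.

Fact dsum_in_subproof k (x : A k) :
  single x \in Submodule finsupp_subproof.
Proof.
apply/asboolP; exists k.+1 => l kl.
by rewrite single_out // neq_ltn kl.
Qed.
Definition dsum_in k (x : A k) : dsum := Subm (dsum_in_subproof x).

Variable f : forall k, {linear A k -> A k.+1}.

(* The direct limit of (A, f) as the direct sum of the A k modulo the relations
   x = f k x; [colim_in_surj] and [colim_in_eq0] describe it elementwise. *)
Definition colim_rel : submodule dsum :=
  span [set z | exists k, exists x : A k,
    z = dsum_in x - dsum_in (f k x)]%classic.

Definition colim : lmodType R := quomod colim_rel.

Definition colim_in k (x : A k) : colim := quo_in colim_rel (dsum_in x).

Lemma dsum_ext (x y : dsum) : (forall k, subm_val x k = subm_val y k) -> x = y.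
Proof. by move=> xy; apply: val_inj; apply: functional_extensionality_dep. Qed.

Fact dsum_in_linear k : linear (@dsum_in k).
Proof.
move=> r x y; apply: dsum_ext => l.
have -> : subm_val (r *: dsum_in x + dsum_in y) l =
          r *: subm_val (dsum_in x) l + subm_val (dsum_in y) l by [].
rewrite /=; have [<-|kl] := eqVneq k l; first by rewrite !single_in.
by rewrite !single_out // scaler0 addr0.
Qed.
HB.instance Definition _ k := GRing.isLinear.Build R (A k) dsum *:%R
  (@dsum_in k) (@dsum_in_linear k).

Fact colim_in_linear k : linear (@colim_in k).
Proof. by move=> r x y; rewrite /colim_in !linearP. Qed.
HB.instance Definition _ k := GRing.isLinear.Build R (A k) colim *:%R
  (@colim_in k) (@colim_in_linear k).

Lemma colim_in_step k (x : A k) : colim_in (f k x) = colim_in x.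
Proof.
apply/esym/quo_in_eq; apply: mem_span.
by exists k, x.
Qed.

Fixpoint push m k (x : A k) : A (m + k) :=
  if m is p.+1 then f (p + k) (push p x) else x.

Lemma colim_in_push m k (x : A k) : colim_in (push m x) = colim_in x.
Proof. by elim: m => //= m IHm; rewrite colim_in_step. Qed.

(* [tot n x] pushes the components of index at most n to A n and adds them. *)
Fixpoint tot n (x : dprod) : A n :=
  if n is p.+1 then f p (tot p x) + x p.+1 else x 0%N.

Lemma tot_linear n r x y : tot n (r *: x + y) = r *: tot n x + tot n y.
Proof.
elim: n => //= n ->; rewrite linearP.
have -> : (r *: x + y) n.+1 = r *: x n.+1 + y n.+1 by [].
by rewrite scalerDr addrACA.
Qed.

Lemma tot_in_lt n k (x : A k) : (n < k)%N -> tot n (single x) = 0.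
Proof.
elim: n => [|n IHn] nk /=; first by rewrite single_out // gtn_eqF.
by rewrite IHn ?(ltnW nk) // linear0 add0r single_out // gtn_eqF.
Qed.

Lemma tot_in k (x : A k) : tot k (single x) = x.
Proof.
case: k x => [|k] x /=; first by rewrite single_in.
by rewrite tot_in_lt // linear0 add0r single_in.
Qed.

Lemma tot_in_push m k (x : A k) :
  tot (m + k) (single x) = push m x.
Proof.
elim: m => [|m IHm]; first exact: tot_in.
rewrite /= -IHm [X in _ + X]single_out ?addr0 //.
by rewrite neq_ltn ltnS leq_addl.
Qed.

Fact tot_ker_subproof : submod_closed (fun z : dsum =>
  `[< exists N, forall n, (N <= n)%N -> tot n (subm_val z) = 0 >]).
Proof.
split.
  apply/asboolP; exists 0%N => n _; elim: n => //= n IHn.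
  by rewrite [X in f n X]IHn linear0 add0r.
move=> r x y /asboolP[m xm] /asboolP[n yn]; apply/asboolP.
exists (maxn m n) => k; rewrite geq_max => /andP[mk nk].
by rewrite [LHS](tot_linear k r (subm_val x)) xm // yn // scaler0 addr0.
Qed.

Lemma colim_in_eq0 k (x : A k) : colim_in x = 0 <-> exists m, push m x = 0.
Proof.
split=> [/quo_in_eq0 x0|[m x0]]; last first.
  by rewrite -(colim_in_push m) x0 linear0.
suff /asboolP[N xN] : dsum_in x \in Submodule tot_ker_subproof.
  by exists N; rewrite -tot_in_push; apply/xN/leq_addr.
apply: (span_sub _ x0) => z [l [y ->]]; apply/asboolP; exists l.+1 => n.
set u : dprod := subm_val _.
have uE : u = (-1) *: single (f l y) + single y.
  by rewrite scaleN1r addrC.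
elim: n => // n IHn; rewrite ltnS leq_eqVlt => /orP[/eqP e|ln] /=.
  subst l; rewrite uE tot_linear tot_in tot_in_lt // scaler0 add0r.
  have -> : ((-1) *: single (f n y) + single y) n.+1 =
    (-1) *: single (f n y) n.+1 + single y n.+1 by [].
  by rewrite single_in single_out ?neq_ltn ?ltnSn // scaleN1r addr0 subrr.
rewrite IHn // linear0 add0r uE.
have -> : ((-1) *: single (f l y) + single y) n.+1 =
  (-1) *: single (f l y) n.+1 + single y n.+1 by [].
by rewrite !single_out ?scaler0 ?addr0 // neq_ltn ltnS ?ln // ltnW // ltnS.
Qed.

Lemma colim_in_surj (z : colim) : exists k, exists x : A k, colim_in x = z.
Proof.
suff bounded n (y : dsum) : (forall k, (n < k)%N -> subm_val y k = 0) ->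
    quo_in colim_rel y = colim_in (tot n (subm_val y)).
  rewrite -[z]quo_inK; set y := repr _.
  have /asboolP[n yn] := valP y.
  exists n, (tot n (subm_val y)); rewrite -(bounded n) // => k /ltnW; exact: yn.
elim: n y => [|n IHn] y yn.
  congr quo_in; apply: dsum_ext => k /=.
  case: k => [|k]; first by rewrite single_in.
  by rewrite yn // single_out.
have yK : y = (y - dsum_in (subm_val y n.+1)) + dsum_in (subm_val y n.+1).
  by rewrite subrK.
rewrite {1}yK quo_inD IHn; last first.
  move=> k nk; have -> : subm_val (y - dsum_in (subm_val y n.+1)) k =
    subm_val y k - single (subm_val y n.+1) k by [].
  have [<-|nk'] := eqVneq n.+1 k; first by rewrite single_in subrr.
  by rewrite single_out // subr0 yn // ltn_neqAle nk' nk.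
have -> : subm_val (y - dsum_in (subm_val y n.+1)) =
    (-1) *: single (subm_val y n.+1) + subm_val y.
  by rewrite scaleN1r addrC.
rewrite tot_linear tot_in_lt // scaler0 add0r -(colim_in_step (tot n _)).
by rewrite -linearD.
Qed.

End SequentialColimit.

Section LocalCohomology.
Variable R : comNzRingType.

(* Ideals need not be proper, unlike the library's [idealr]. *)
Definition ideal := submodule (R^o : lmodType R).

Definition mulmod (I : ideal) (V : lmodType R) (U : submodule V) :
    submodule V :=
  span [set z | exists r : R, exists x : V,
    [/\ r \in I, x \in U & z = r *: x]]%classic.

Fixpoint expideal (I : ideal) (k : nat) : ideal :=
  if k is j.+1 then mulmod I (expideal I j) else full R^o.

Variables (a : ideal) (M : lmodType R).

Definition power_quo (k : nat) : lmodType R :=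
  quomod (mulmod (expideal a k) (full M)).

Fact power_quo_proj_subproof k x :
    x \in mulmod (expideal a k.+1) (full M) ->
  idfun x \in mulmod (expideal a k) (full M).
Proof.
move=> xU; apply: (span_sub _ xU) => z [r [y [ra _ ->]]].
apply: mem_span; exists r, y; split=> //.
apply: (span_sub _ ra) => z' [s [t [_ ta ->]]].
exact: (@rpredZ _ _ (expideal a k)).
Qed.

Definition power_quo_proj k : {linear power_quo k.+1 -> power_quo k} :=
  quo_map (@power_quo_proj_subproof k).

Definition gen_local_cohomology (X : lmodType R) (i : nat) : lmodType R :=
  colim (fun k => ext_map X (power_quo_proj k) i).

End LocalCohomology.

Definition local_cohomology (R : comNzRingType) (a : ideal R) (X : lmodType R)
    (i : nat) : lmodType R :=
  gen_local_cohomology a R^o X i.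

Definition noetherian (R : comNzRingType) : Prop :=
  forall I : ideal R, exists s : seq R^o, I =i span [set` s]%classic.

Definition finitely_generated (R : comNzRingType) (M : lmodType R) : Prop :=
  exists s : seq M, full M =i span [set` s]%classic.

Definition short_exact (R : comNzRingType) (X' X X'' : lmodType R)
    (f : {linear X' -> X}) (g : {linear X -> X''}) : Prop :=
  [/\ injective f, immod f =i kermod g & forall y, exists x, g x = y].

Definition serre_subcategory (R : comNzRingType) (S : lmodType R -> Prop) :
    Prop :=
  (exists X, S X) /\
  (forall (X' X X'' : lmodType R) (f : {linear X' -> X}) (g : {linear X -> X''}),
     short_exact f g -> (S X <-> S X' /\ S X'')).

(* Main.v *)
From HB Require Import structures.
From mathcomp Require Import all_boot all_order all_algebra.
From mathcomp Require Import generic_quotient ring_quotient.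
From mathcomp Require Import boolp classical_sets functions.
From mathcomp.multinomials Require Import freeg.
Require Import Defs.

Set Implicit Arguments.
Unset Strict Implicit.
Unset Printing Implicit Defensive.

Import Order.TTheory GRing.Theory Num.Theory.
Local Open Scope ring_scope.
Local Open Scope quotient_scope.

(** Let X_0 = X, let E_q be an injective module containing X_q and let
    X_{q+1} = E_q / X_q.  Dimension shifting in the second argument gives, for
    i > 0, an isomorphism

      Ext^i(M, X) = Hom(M, X_i) / (the maps that lift to E_{i-1}),

    natural in M.  The modules E_q do not depend on M, so it passes to the limit
    over the quotients M/a^k M.  Call a linear map out of M torsion if it kills
    some a^k M.  Then H^i_a(M, X) is the module of torsion maps M -> X_i modulo
    those which lift to a torsion map M -> E_{i-1} ([coh_class_eq0] and its
    neighbours); for i = 0 it is just the module of torsion maps M -> X.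

    In this form the exact sequences in M only require that torsion maps into an
    injective module extend, as torsion maps, from a submodule U of a finitely
    generated module F to F ([torsion_extension]).  This is injectivity together
    with a weak form of the Artin-Rees lemma ([weak_artin_rees]): for each m
    some a^l F meets U inside a^m U.  For F/U = M the usual diagram chases then
    show, for a Serre class S, that

      - H^i(U), H^{i+1}(F) in S imply H^{i+1}(M) in S, and H^0(F) in S implies
        H^0(M) in S ([serre_quotient_degS], [serre_quotient_deg0]);
      - H^i(M), H^i(U) in S imply H^i(F) in S ([serre_middle]).

    One direction of the theorem is the case M = R.  The other is an induction on
    i.  A cyclic module is a quotient of R by an ideal, which is finitely
    generated, so the first item and the previous degree settle it
    ([serre_cyclic]).  A module with k+1 generators is an extension of a cyclic
    module by a module with k generators, so the second item settles it by
    induction on k ([serre_finitely_generated]). *)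

(** * Maximal sets closed under operations *)

Definition closed_under (V I : Type) (op : I -> V -> V -> V) (L : set V) :=
  forall i x y, L x -> L y -> L (op i x y).

(** Two uses of Zorn's lemma have this shape: partial additive maps, seen as
    subgroups avoiding the pairs (0, d) with d nonzero, and the submodules whose
    intersection with a given K stays inside a given N. *)
Lemma maximal_closed (V I : Type) (op : I -> V -> V -> V) (L0 A : set V) :
    closed_under op L0 -> (forall x, L0 x -> ~ A x) ->
  exists L : set V, [/\ closed_under op L, forall x, L0 x -> L x,
    forall x, L x -> ~ A x &
    forall L' : set V, closed_under op L' -> (forall x, L x -> L' x) ->
      (forall x, L' x -> ~ A x) -> forall x, L' x -> L x].
Proof.
move=> L0op L0A.
pose Q (L : set V) := [/\ closed_under op L, forall x, L0 x -> L x &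
  forall x, L x -> ~ A x].
(* The chain in Zorn's lemma may be empty, so the empty set is let in. *)
pose P (L : set V) := forall x, L x -> Q L.
have [F FP Ftot|L [PL Lmax]] := @Zorn_bigcup _ P.
  move=> x [X FX Xx]; split.
  - move=> i y z [Y FY Yy] [Z FZ Zz].
    have [YZ|ZY] := Ftot _ _ FY FZ.
      by exists Z => //; case: (FP _ FZ _ Zz) => + _ _; apply; [apply: YZ|].
    by exists Y => //; case: (FP _ FY _ Yy) => + _ _; apply; [|apply: ZY].
  - by move=> y L0y; exists X => //; case: (FP _ FX _ Xx) => _ + _; apply.
  - by move=> y [Y FY Yy]; case: (FP _ FY _ Yy) => _ _; apply.
have step L' : Q L' -> (forall x, L x -> L' x) -> forall x, L' x -> L x.
  move=> QL' LL' x L'x; apply: contrapT => nLx.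
  apply: (Lmax L') => //; split=> // /(_ x L'x); exact: nLx.
have L0L x : L0 x -> L x.
  move=> L0x; have [[y Ly]|nL] := pselect (exists y, L y).
    by case: (PL y Ly) => _ + _; apply.
  by apply: (step L0) => // y Ly; case: nL; exists y.
exists L; split=> //.
- by move=> i x y Lx; case: (PL x Lx) => + _ _; apply.
- by move=> x Lx; case: (PL x Lx) => _ _; apply.
- by move=> L' L'op LL' L'A; apply: step => //; split=> // x /L0L/LL'.
Qed.

(** * Injective modules *)

Definition intQ : GRing.ZmodClosed.type rat :=
  (@Num.int_num_subdef rat : {pred rat}).
(** Q/Z, an injective cogenerator of the category of abelian groups. *)
Definition QZ : zmodType := Quotient.quot intQ.
Definition qz (r : rat) : QZ := \pi_(Quotient.quot intQ) r.

Lemma qzD r s : qz (r + s) = qz r + qz s.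
Proof. exact: Quotient.pi_add. Qed.

Lemma qz_eq0 r : (qz r = 0) <-> r \is a Num.int.
Proof.
have <- : qz 0 = 0 by apply: (addrI (qz 0)); rewrite -qzD !addr0.
rewrite -[X in X \is a _]subr0 Quotient.idealrBE.
by split=> [/eqP|/eqP].
Qed.

Lemma qzMn r m : qz (r *+ m) = qz r *+ m.
Proof.
have qz0 : qz 0 = 0 by apply/qz_eq0; rewrite rpred0.
by elim: m => [|m IHm]; rewrite ?mulr0n // !mulrS qzD IHm.
Qed.

Lemma qz_surj (d : QZ) : exists r, qz r = d.
Proof. by exists (repr d); exact: reprK. Qed.

(** Beyond divisibility, the quotient can be chosen nonzero; this is what makes
    Q/Z a cogenerator, and it lets [graph_like_step] serve both to extend maps and
    to separate points. *)
Lemma QZ_div m (e : QZ) : (0 < m)%N ->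
  exists d : QZ, d *+ m = e /\ ((1 < m)%N -> d != 0).
Proof.
move=> m0; have mQ0 : m%:R != 0 :> rat by rewrite pnatr_eq0 -lt0n.
have [->|e0] := eqVneq e 0; last first.
  have [r re] := qz_surj e; subst e; exists (qz (r / m%:R)).
  rewrite -qzMn -[X in qz X]mulr_natr divfK //; split=> // _.
  apply: contraNneq e0 => d0.
  by rewrite -[r](divfK mQ0) [X in qz X]mulr_natr qzMn d0 mul0rn.
exists (qz (m%:R^-1)); rewrite -qzMn -[X in qz X]mulr_natr.
rewrite mulVf //; split.
  by apply/qz_eq0; rewrite rpred1.
move=> m1; apply/eqP => /qz_eq0 /Num.Theory.intrP[z zE].
have : (m%:Z * z)%:~R = 1%:~R :> rat by rewrite intrM -zE mulfV.
move=> /intr_inj mz.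
by move/(congr1 absz)/eqP: mz m1; rewrite abszM /= muln_eq1 => /andP[/eqP ->].
Qed.

Definition subgroup (B : zmodType) (G : set B) :=
  G 0 /\ forall x y, G x -> G y -> G (x - y).

Lemma subrACA (C : zmodType) (p q u v : C) : p - q - (u - v) = p - u - (q - v).
Proof. by rewrite !opprB [v - u]addrC [v - q]addrC addrACA. Qed.

Section AdditiveExtension.
Variable B : zmodType.

(** A homomorphism from a subgroup of [B] to Q/Z, encoded by its graph. *)
Definition graph_like (G : set (B * QZ)) :=
  subgroup G /\ forall d, G (0, d) -> d = 0.

Lemma subgroupN (C : zmodType) (G : set C) x : subgroup G -> G x -> G (- x).
Proof. by move=> [G0 GB] /(GB _ _ G0); rewrite sub0r. Qed.

Lemma subgroupD (C : zmodType) (G : set C) x y :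
  subgroup G -> G x -> G y -> G (x + y).
Proof.
by move=> sG Gx Gy; rewrite -[y]opprK; apply: sG.2 => //; apply: subgroupN.
Qed.

Lemma subgroupMn (C : zmodType) (G : set C) x n :
  subgroup G -> G x -> G (x *+ n).
Proof.
move=> sG Gx; elim: n => [|n IHn]; first by rewrite mulr0n; case: sG.
by rewrite mulrS; apply: subgroupD.
Qed.

Lemma pairMn (C D : zmodType) (x : C) (y : D) n :
  (x, y) *+ n = (x *+ n, y *+ n).
Proof. by elim: n => [|n IHn]; rewrite ?mulr0n // !mulrS IHn. Qed.

(** The value at [b] has to be compatible with the multiples of [b] that lie in
    the domain already.  They are the multiples of [m b] for the least such
    m > 0, so dividing the value at [m b] by [m] works; if there is no such
    multiple, any value does. *)
Lemma graph_like_step (G : set (B * QZ)) b : graph_like G ->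
    (forall d, ~ G (b, d)) ->
  exists (d : QZ) (G' : set (B * QZ)), [/\ d != 0, graph_like G',
    G' (b, d) & forall x, G x -> G' x].
Proof.
move=> [sG fG] bG.
suff [d [d0 dP]] : exists d : QZ, d != 0 /\
    forall n e, G (b *+ n, e) -> e = d *+ n.
  exists d; pose G' : set (B * QZ) := fun x => exists n : int,
    G (x.1 - b *~ n, x.2 - d *~ n).
  have dPz (n : int) e : G (b *~ n, e) -> e = d *~ n.
    case: n => n; first exact: dP.
    rewrite NegzE !mulrNz => Ge; apply: oppr_inj; rewrite opprK; apply: dP.
    by rewrite -[b *+ _]opprK; apply: (subgroupN sG Ge).
  exists G'; split=> //; first split; first split.
  - by exists 0; rewrite !mulr0z !subr0; case: sG.
  - move=> [x1 x2] [y1 y2] [m /= Gm] [n /= Gn]; exists (m - n).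
    have /= := sG.2 _ _ Gm Gn.
    by congr (G (_, _)); rewrite subrACA mulrzBr.
  - move=> e [n /=]; rewrite sub0r -mulrNz => /dPz.
    by rewrite mulrNz => /(canRL (subrK _)); rewrite addNr.
  - by exists 1; rewrite !mulr1z !subrr; case: sG.
  - by move=> [x1 x2] Gx; exists 0; rewrite !mulr0z !subr0.
pose p n := (0 < n)%N && `[< exists e, G (b *+ n, e) >].
have [exp|noG] := pselect (exists n, p n).
  have [m /andP[m0 /asboolP[e Gm]] mmin] := ex_minnP exp.
  have m1 : (1 < m)%N.
    rewrite ltn_neqAle m0 andbT; apply/eqP => m1.
    by move: Gm; rewrite -m1 mulr1n => /bG.
  have [d [dm /(_ m1) d0]] := QZ_div e m0; exists d; split=> // n e' Gn.
  have Gr : G (b *+ (n %% m), e' - e *+ (n %/ m)).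
    have := sG.2 _ _ Gn (subgroupMn (n %/ m) sG Gm); rewrite pairMn.
    congr (G (_, _)); rewrite -mulrnA {1}(divn_eq n m) mulrnDr mulnC.
    by rewrite addrAC subrr add0r.
  have r0 : (n %% m = 0)%N.
    apply: contraTeq (ltn_pmod n m0); rewrite -lt0n -leqNgt => r0.
    by apply: mmin; rewrite /p r0 /=; apply/asboolP; exists (e' - e *+ (n %/ m)).
  move: Gr; rewrite r0 mulr0n => /fG /(canRL (subrK _)); rewrite add0r => ->.
  by rewrite -dm -mulrnA mulnC {2}(divn_eq n m) r0 addn0.
have [d [_ /(_ isT) d0]] := QZ_div 0 (isT : (0 < 2)%N).
exists d; split=> // -[|n] e Gn; first by rewrite mulr0n; apply: fG.
by case: noG; exists n.+1; apply/andP; split=> //; apply/asboolP; exists e.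
Qed.

Lemma additive_extension (G : set (B * QZ)) : graph_like G ->
  exists chi : {additive B -> QZ}, forall b d, G (b, d) -> chi b = d.
Proof.
move=> [sG fG].
pose op (_ : unit) (x y : B * QZ) := x - y.
pose A : set (B * QZ) := fun x => x.1 = 0 /\ x.2 != 0.
have [|x Gx [x1 /eqP x2]|L [Lop GL LA Lmax]] := @maximal_closed _ _ op G A.
- by move=> [] x y; apply: sG.2.
- by case: x x1 x2 Gx => x1 x2 /= -> nx2 /fG.
have sL : subgroup L by split; [apply: GL; case: sG|move=> x y; apply: (Lop tt)].
have fL d : L (0, d) -> d = 0.
  move=> /LA Ld; apply/eqP/negPn/negP => d0; exact: Ld.
have Ltot b : exists d, L (b, d).
  apply: contrapT => Lb.
  have [d [L' [_ [sL' fL'] L'b LL']]] : exists d L', [/\ d != 0, graph_like L',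
      L' (b, d) & forall x, L x -> L' x].
    by apply: graph_like_step => // d Ld; apply: Lb; exists d.
  apply: Lb; exists d; apply: (Lmax L') => //.
    by move=> [] x y; apply: sL'.2.
  move=> [x1 x2] L'x /= [/= x10]; rewrite x10 in L'x.
  by rewrite (fL' _ L'x) eqxx.
have [chi chiP] := choice Ltot.
have chi_eq b d : L (b, d) -> chi b = d.
  move=> Lbd; apply/eqP; rewrite -subr_eq0; apply/eqP/fL.
  by rewrite -(subrr b); apply: (sL.2 _ _ (chiP b) Lbd).
have chiB : zmod_morphism chi.
  by move=> x y; apply: chi_eq; apply: (sL.2 _ _ (chiP x) (chiP y)).
pose f : {additive B -> QZ} :=
  HB.pack chi (GRing.isZmodMorphism.Build _ _ chi chiB).
by exists f => b d /GL/chi_eq.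
Qed.

(** Start from the zero homomorphism on 0 and choose a nonzero value at [b]. *)
Lemma additive_separation (b : B) : b != 0 ->
  exists chi : {additive B -> QZ}, chi b != 0.
Proof.
move=> b0; pose G : set (B * QZ) := fun x => x = 0.
have gG : graph_like G.
  split; first split=> // x y -> ->; first by rewrite /G subrr.
  by move=> d [].
have [|d [G' [d0 gG' G'b _]]] := graph_like_step (b := b) gG.
  by move=> d [/eqP]; rewrite (negPf b0).
by have [chi chiP] := additive_extension gG'; exists chi; rewrite (chiP b d).
Qed.

End AdditiveExtension.

(** For an abelian group [D], the R-module of additive maps R -> D is coinduced
    from [D], so that R-linear maps into it are additive maps into [D].  The
    module [coind Y] is the product of copies of Hom_Z(R, Q/Z) indexed by the
    characters of [Y]; the evaluations embed [Y] into it. *)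
Section Coinduced.
Variables (R : comNzRingType) (Y : lmodType R).

Definition coind_pred : {pred {additive Y -> QZ} -> R -> QZ} :=
  fun h => `[< forall chi, zmod_morphism (h chi) >].

Fact coind_subproof : zmod_closed coind_pred.
Proof.
split; first by apply/asboolP => chi r s; rewrite /= subrr.
move=> g h /asboolP gP /asboolP hP; apply/asboolP => chi r s.
by rewrite !fctE gP hP subrACA.
Qed.
HB.instance Definition _ := GRing.isZmodClosed.Build _ coind_pred coind_subproof.

Record coind := Coind { coind_val : {additive Y -> QZ} -> R -> QZ;
  _ : coind_val \in coind_pred }.
HB.instance Definition _ := [isSub for coind_val].
HB.instance Definition _ := [Choice of coind by <:].
HB.instance Definition _ := [SubChoice_isSubZmodule of coind by <:].

Lemma coindB (h : coind) chi r s :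
  coind_val h chi (r - s) = coind_val h chi r - coind_val h chi s.
Proof. by case: h => h /= /asboolP hP; apply: hP. Qed.

Lemma coindD (h : coind) chi r s :
  coind_val h chi (r + s) = coind_val h chi r + coind_val h chi s.
Proof.
have h0 : coind_val h chi 0 = 0 by rewrite -(subrr (0 : R)) coindB subrr.
by rewrite -{1}[s]opprK coindB -[- s]sub0r coindB h0 sub0r opprK.
Qed.

Lemma coind_ext (g h : coind) :
  (forall chi r, coind_val g chi r = coind_val h chi r) -> g = h.
Proof. by move=> gh; apply/val_inj/funext => chi; apply/funext. Qed.

Fact coind_scale_subproof (r : R) (h : coind) :
  (fun chi s => coind_val h chi (s * r)) \in coind_pred.
Proof. by apply/asboolP => chi s t; rewrite mulrBl coindB. Qed.
Definition coind_scale r h := Coind (coind_scale_subproof r h).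

Fact coind_scaleA r s h : coind_scale r (coind_scale s h) = coind_scale (r * s) h.
Proof. by apply: coind_ext => chi t /=; rewrite mulrA. Qed.
Fact coind_scale1 : left_id 1 coind_scale.
Proof. by move=> h; apply: coind_ext => chi t /=; rewrite mulr1. Qed.
Fact coind_scaleDr : right_distributive coind_scale +%R.
Proof. by move=> r g h; apply: coind_ext. Qed.
Fact coind_scaleDl h : {morph coind_scale^~ h : r s / r + s}.
Proof. by move=> r s; apply: coind_ext => chi t /=; rewrite mulrDr coindD. Qed.
HB.instance Definition _ := GRing.Zmodule_isLmodule.Build R coind
  coind_scaleA coind_scale1 coind_scaleDr coind_scaleDl.

Fact coind_in_subproof (y : Y) :
  (fun (chi : {additive Y -> QZ}) r => chi (r *: y)) \in coind_pred.
Proof. by apply/asboolP => chi r s; rewrite scalerBl raddfB. Qed.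
Definition coind_in y := Coind (coind_in_subproof y).

Fact coind_in_linear : linear coind_in.
Proof.
move=> r x y; apply: coind_ext => chi s.
by rewrite /= scalerDr raddfD scalerA.
Qed.
HB.instance Definition _ := GRing.isLinear.Build R Y coind *:%R coind_in
  coind_in_linear.

Lemma coind_in_inj : injective coind_in.
Proof.
apply: raddf_inj => y y0; apply/eqP; apply: contrapT => /negP.
move=> /additive_separation[chi /eqP chiy]; apply: chiy.
by have := congr1 (fun h => coind_val h chi 1) y0; rewrite /= scale1r.
Qed.

End Coinduced.

Definition injective_module (R : comNzRingType) (E : lmodType R) :=
  forall (A B : lmodType R) (i : {linear A -> B}) (f : {linear A -> E}),
    injective i -> exists g : {linear B -> E}, forall x, g (i x) = f x.

(** By coinduction the components of [f] amount to additive maps A -> Q/Z, one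
    for each character, and these extend to [B]. *)
Lemma coind_injective (R : comNzRingType) (Y : lmodType R) :
  injective_module (coind Y).
Proof.
move=> A B i f inji.
have ext chi : exists g : {additive B -> QZ},
    forall x, g (i x) = coind_val (f x) chi 1.
  pose G : set (B * QZ) := fun b => exists x, b = (i x, coind_val (f x) chi 1).
  have [|g gP] := @additive_extension _ G; last first.
    by exists g => x; apply: gP; exists x.
  split; first split.
  - by exists 0; rewrite !linear0.
  - by move=> _ _ [x ->] [y ->]; exists (x - y); rewrite !linearB.
  - move=> d [x []]; rewrite -(linear0 i) => /inji <- ->.
    by rewrite linear0.
have [g gP] := choice ext.
have gZ (b : B) : (fun chi r => g chi (r *: b)) \in @coind_pred R Y.
  by apply/asboolP => chi r s; rewrite scalerBl raddfB.
pose h b := Coind (gZ b).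
have hlin : linear h.
  by move=> r x y; apply: coind_ext => chi s; rewrite /= scalerDr raddfD scalerA.
pose hl : {linear B -> coind Y} :=
  HB.pack h (GRing.isLinear.Build R B (coind Y) *:%R h hlin).
exists hl => x; apply: coind_ext => chi s.
by rewrite /= -linearZ gP linearZ /= mul1r.
Qed.

(** * Linear maps from linear relations *)

Lemma quo_in_surj (R : comNzRingType) (V : lmodType R) (U : submodule V)
  (z : quomod U) : exists x, quo_in U x = z.
Proof. by exists (repr (z : Quotient.quot U)); exact: quo_inK. Qed.

Definition sub_in (R : comNzRingType) (V : lmodType R) (U : submodule V) :
  {linear subm U -> V} := val.

Lemma sub_in_inj (R : comNzRingType) (V : lmodType R) (U : submodule V) :
  injective (sub_in U).
Proof. exact: val_inj. Qed.

Section LinearMaps.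
Variable R : comNzRingType.
Implicit Types U V W X Y E : lmodType R.

Definition mk_linear V W (f : V -> W) (fl : linear f) : {linear V -> W} :=
  HB.pack f (GRing.isLinear.Build R V W *:%R f fl).

(** Most linear maps below arise by solving an equation whose solution is unique
    without being given by a formula; they are built from their graphs. *)
Lemma linear_relation V W (D : V -> W -> Prop) :
    (forall r v v' w w', D v w -> D v' w' -> D (r *: v + v') (r *: w + w')) ->
    (forall v, exists w, D v w) -> (forall w, D 0 w -> w = 0) ->
  exists f : {linear V -> W}, forall v, D v (f v).
Proof.
move=> Dlin Dtot D0; have [f fP] := choice Dtot.
have Duniq v w w' : D v w -> D v w' -> w = w'.
  move=> Dw Dw'; apply/esym/eqP; rewrite -subr_eq0 addrC -scaleN1r; apply/eqP/D0.
  by rewrite -(addNr v) -scaleN1r; apply: Dlin.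
have fl : linear f by move=> r x y; apply: Duniq (fP _) (Dlin _ _ _ _ _ _ _).
by exists (mk_linear fl).
Qed.

Lemma factor_surjective V W Y (g : {linear V -> W}) (f : {linear V -> Y}) :
    (forall w, exists v, g v = w) -> (forall v, g v = 0 -> f v = 0) ->
  exists h : {linear W -> Y}, forall v, h (g v) = f v.
Proof.
move=> gsurj gf.
have [r|w|y [v [/gf -> ->]]//|h hP] := @linear_relation W Y
  (fun w y => exists v, g v = w /\ f v = y).
- move=> _ _ _ _ [x [<- <-]] [y [<- <-]]; exists (r *: x + y).
  by rewrite !linearP.
- by have [v vw] := gsurj w; exists (f v), v.
- exists h => v; have [x [gx <-]] := hP (g v).
  by apply/eqP; rewrite -subr_eq0 -linearB gf // linearB gx subrr.
Qed.

Lemma factor_injective V X Y (i : {linear X -> Y}) (f : {linear V -> Y}) :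
    injective i -> (forall v, exists x, i x = f v) ->
  exists h : {linear V -> X}, forall v, i (h v) = f v.
Proof.
move=> inji fi; apply: (linear_relation (D := fun v x => i x = f v)) => //.
  by move=> r v v' w w' /= e e'; rewrite !linearP e e'.
by move=> w; rewrite linear0 -(linear0 i) => /inji.
Qed.

Lemma lift_free (T : choiceType) X Y (p : {linear X -> Y})
    (f : {linear free_mod R T -> Y}) :
    (forall y, exists x, p x = y) ->
  exists h : {linear free_mod R T -> X}, forall v, p (h v) = f v.
Proof.
move=> psurj; have [g gP] := choice (fun t : T => psurj (f << t >>)).
exists (free_lift g : {linear _ -> _}) => v.
pose ph : {linear free_mod R T -> Y} := p \o free_lift g.
suff : ph =1 f by apply.
by apply: free_ext => t; rewrite /= free_liftU.
Qed.

(** A map that kills the kernel of [d] is defined on the image of [d], and extends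
    from there. *)
Lemma injective_factor U V E (d : {linear U -> V}) (f : {linear U -> E}) :
    injective_module E -> (forall x, d x = 0 -> f x = 0) ->
  exists g : {linear V -> E}, forall x, g (d x) = f x.
Proof.
move=> injE df; pose j := sub_in (immod d).
have jinj : injective j by exact: sub_in_inj.
have [v|e eP] := @factor_injective U (subm (immod d)) V j d jinj.
  have vd : d v \in immod d by apply/asboolP; exists v.
  by exists (Subm vd).
have [z|x ex0|f' f'P] := @factor_surjective U (subm (immod d)) E e f.
- have /asboolP[x xz] := valP z; exists x; apply: jinj; rewrite eP; exact: xz.
- by apply: df; rewrite -eP ex0 linear0.
have [g gP] := injE _ _ j f' jinj.
by exists g => x; rewrite -eP gP f'P.
Qed.

End LinearMaps.

(** * Serre subcategories *)

Section Serre.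
Variables (R : comNzRingType) (S : lmodType R -> Prop).
Hypothesis serreS : serre_subcategory S.

Lemma serre_sub (U V : lmodType R) (f : {linear U -> V}) :
  injective f -> S V -> S U.
Proof.
move=> finj; have [_ /(_ U V (quomod (immod f)) f (quo_in (immod f)))] := serreS.
case=> [|SV _ /SV[]//]; split=> //.
  by move=> y; apply/idP/idP => [yf|/eqP/quo_in_eq0//]; apply/eqP/quo_in_eq0.
exact: quo_in_surj.
Qed.

Lemma serre_quo (U V : lmodType R) (f : {linear U -> V}) :
  (forall y, exists x, f x = y) -> S U -> S V.
Proof.
move=> fsurj; pose j := sub_in (kermod f).
have [_ /(_ _ _ _ j f)[|SU _ /SU[]//]] := serreS.
split=> //.
move=> x; apply/idP/idP => [/asboolP[z <-]|xf]; first exact: (valP z).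
by apply/asboolP; exists (Subm xf).
Qed.

Definition linear_rel (V W : lmodType R) (D : V -> W -> Prop) :=
  D 0 0 /\ forall r v v' w w', D v w -> D v' w' -> D (r *: v + v') (r *: w + w').

(** The relation, as a submodule of [V * W], embeds into [V] and maps onto [W]. *)
Lemma serre_subquotient (V W : lmodType R) (D : V -> W -> Prop) :
    linear_rel D -> (forall w, D 0 w -> w = 0) -> (forall w, exists v, D v w) ->
  S V -> S W.
Proof.
move=> [D00 Dlin] D0 Dsurj SV.
have Dsub : submod_closed (fun z : V * W => `[< D z.1 z.2 >]).
  split; first exact/asboolP.
  by move=> r x y /asboolP Dx /asboolP Dy; apply/asboolP/Dlin.
pose Z := Submodule Dsub.
have pl : linear (fun z : subm Z => (val z).1) by move=> r x y; rewrite linearP.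
have ql : linear (fun z : subm Z => (val z).2) by move=> r x y; rewrite linearP.
apply: (@serre_quo _ _ (mk_linear ql)) => [w|].
  have [v Dvw] := Dsurj w; have zZ : (v, w) \in Z by apply/asboolP.
  by exists (Subm zZ).
apply: (serre_sub (f := mk_linear pl)) => //; apply: raddf_inj => z /= z0.
apply: val_inj; have /asboolP := valP z; rewrite z0 => /D0 z20.
by rewrite [LHS]surjective_pairing z0 z20.
Qed.

(** [D1] and [D2] play the maps of an exact sequence V1 -> W -> V2.  Linear
    relations are enough, since the part of [W] related to 0 is a subquotient of
    [V1] and the rest a subquotient of [V2]; so a connecting map, which depends
    on choices, need not be turned into a function. *)
Lemma serre_exact (V1 W V2 : lmodType R) (D1 : V1 -> W -> Prop)
    (D2 : W -> V2 -> Prop) :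
    linear_rel D1 -> (forall w, D1 0 w -> w = 0) ->
    linear_rel D2 -> (forall w, exists v, D2 w v) ->
    (forall w, D2 w 0 -> exists v, D1 v w) ->
  S V1 -> S V2 -> S W.
Proof.
move=> [D100 D1lin] D10 [D200 D2lin] D2tot D21 SV1 SV2.
have Lsub : submod_closed (fun w : W => `[< D2 w 0 >]).
  split; first exact/asboolP.
  move=> r x y /asboolP Dx /asboolP Dy; apply/asboolP.
  by have := D2lin r x y 0 0 Dx Dy; rewrite scaler0 addr0.
pose L := Submodule Lsub; pose j := sub_in L.
have [_ /(_ _ _ _ j (quo_in L))[|_]] := serreS.
  split=> //.
  - move=> w; apply/idP/idP => [/asboolP[z <-]|/eqP/quo_in_eq0 wL].
      by apply/eqP/quo_in_eq0/(valP z).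
    by apply/asboolP; exists (Subm wL).
  - exact: quo_in_surj.
apply; split.
  apply: (serre_subquotient (D := fun v (w : subm L) => D1 v (val w))) SV1.
  - by split=> // r v v' w w'; apply: D1lin.
  - by move=> w /D10 w0; apply: val_inj.
  - by move=> w; have /asboolP/D21 := valP w.
apply: (serre_subquotient
  (D := fun v (z : quomod L) => exists w, D2 w v /\ z = quo_in L w)) SV2.
- split; first by exists 0; rewrite linear0.
  move=> r v v' _ _ [w [Dw ->]] [w' [Dw' ->]]; exists (r *: w + w').
  by rewrite linearP; split=> //; apply: D2lin.
- by move=> _ [w [Dw ->]]; apply/quo_in_eq0/asboolP.
- move=> z; have [w <-] := quo_in_surj z; have [v Dv] := D2tot w.
  by exists v, w.
Qed.

End Serre.

(** * Ext by dimension shifting *)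

(** An injective resolution of [cosyz 0], cut into short exact sequences
    0 -> cosyz q -> hull q -> cosyz (q + 1) -> 0. *)
Record coresolution (R : comNzRingType) := Coresolution {
  cosyz : nat -> lmodType R;
  hull : nat -> lmodType R;
  cor_in : forall q, {linear cosyz q -> hull q};
  cor_out : forall q, {linear hull q -> cosyz q.+1};
  cor_exact : forall q, short_exact (cor_in q) (cor_out q);
  cor_inj : forall q, injective_module (hull q)
}.

Section Coresolution.
Variable R : comNzRingType.
Implicit Types (M N Y : lmodType R) (J : coresolution R).

Definition cosyzygy (X : lmodType R) : nat -> lmodType R :=
  fix loop q := if q is p.+1 then
    quomod (immod (@coind_in R (loop p) : {linear _ -> _})) else X.

Lemma coresolution_exists (X : lmodType R) :
  exists J : coresolution R, cosyz J 0 = X.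
Proof.
unshelve eexists (@Coresolution R (cosyzygy X) (fun q => coind (cosyzygy X q))
  (fun q => @coind_in R _) (fun q => quo_in _) _ _) => //.
- move=> q; split; first exact: coind_in_inj.
    by move=> y; apply/idP/idP => [yf|/eqP/quo_in_eq0//]; apply/eqP/quo_in_eq0.
  exact: quo_in_surj.
- move=> q; exact: coind_injective.
Qed.

Definition shift (J : coresolution R) : coresolution R :=
  Coresolution (fun q => @cor_exact R J q.+1) (fun q => @cor_inj R J q.+1).

Lemma cor_in_inj (J : coresolution R) q : injective (cor_in J q).
Proof. by case: (cor_exact J q). Qed.

Lemma cor_out_surj (J : coresolution R) q y : exists x, cor_out J q x = y.
Proof. by case: (cor_exact J q). Qed.

Lemma cor_outP (J : coresolution R) q y :
  cor_out J q y = 0 <-> exists x, cor_in J q x = y.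
Proof.
have [_ /(_ y) e _] := cor_exact J q.
split=> [/eqP y0|/asboolP]; first by apply/asboolP; rewrite [asbool _]e.
by rewrite [asbool _]e => /eqP.
Qed.

Lemma cor_out_in (J : coresolution R) q x : cor_out J q (cor_in J q x) = 0.
Proof. by apply/cor_outP; exists x. Qed.

Definition cocycle (M Y : lmodType R) i (c : {linear res M i -> Y}) :=
  forall x, c (res_d M i x) = 0.

Definition coboundary (M Y : lmodType R) i : {linear res M i -> Y} -> Prop :=
  if i is j.+1 then fun c =>
    exists v : {linear res M j -> Y}, forall x, c x = v (res_d M j x)
  else fun c => forall x, c x = 0.

(** The connecting map Ext^i(M, cosyz 1) -> Ext^{i+1}(M, cosyz 0) on cocycles, as
    a relation: lift [c'] to the hull and differentiate the lift. *)
Definition shifts_to (M : lmodType R) (J : coresolution R) i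
    (c' : {linear res M i -> cosyz J 1}) (c : {linear res M i.+1 -> cosyz J 0}) :=
  exists u : {linear res M i -> hull J 0},
    (forall x, cor_out J 0 (u x) = c' x) /\
    (forall x, u (res_d M i x) = cor_in J 0 (c x)).

(** The composite Hom(M, cosyz i) -> Ext^1(M, cosyz (i - 1)) -> ... ->
    Ext^i(M, cosyz 0) of connecting maps, on cocycles.  It is kept as a relation,
    so that naturality in [M] holds on the nose, whatever lifts are chosen. *)
Fixpoint zigzag (M : lmodType R) (i : nat) : forall J : coresolution R,
    {linear M -> cosyz J i} -> {linear res M i -> cosyz J 0} -> Prop :=
  if i is j.+1 then fun J phi c =>
    exists c' : {linear res M j -> cosyz J 1},
      @zigzag M j (shift J) phi c' /\ shifts_to c' c
  else fun J phi c => forall x, c x = phi (free_eps x).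

(** The maps that [zigzag] sends to 0 in Ext. *)
Definition lifts_to_hull (M : lmodType R) (J : coresolution R) (i : nat) :
    {linear M -> cosyz J i} -> Prop :=
  if i is j.+1 then fun phi =>
    exists psi : {linear M -> hull J j}, forall x, phi x = cor_out J j (psi x)
  else fun phi => forall x, phi x = 0.

Lemma zigzag_linear M i J (phi phi' phi'' : {linear M -> cosyz J i})
    (c c' c'' : {linear res M i -> cosyz J 0}) r :
    (forall x, phi'' x = r *: phi x + phi' x) ->
    (forall x, c'' x = r *: c x + c' x) ->
  zigzag phi c -> zigzag phi' c' -> zigzag phi'' c''.
Proof.
elim: i J phi phi' phi'' c c' c'' => [|i IHi] J phi phi' phi'' c c' c'' pE cE /=.
  by move=> pc pc' x; rewrite cE pc pc' pE.
move=> [b [pb [u [ub uc]]]] [b' [pb' [u' [ub' uc']]]].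
exists (r \*: b \+ b'); split; first exact: (IHi (shift J)) pb pb'.
exists (r \*: u \+ u'); split=> x /=; first by rewrite linearP ub ub'.
by rewrite uc uc' cE linearP.
Qed.

Lemma res_dd M i x : res_d M i (res_d M i.+1 x) = 0 :> res M i.
Proof. by apply/res_exact; exists x. Qed.

Lemma free_eps_d (M : lmodType R) x : free_eps (res_d M 0 x) = 0.
Proof. by apply/res_exact0; exists x. Qed.

Lemma shifts_to_cocycle M J i (c' : {linear res M i -> cosyz J 1})
  (c : {linear res M i.+1 -> cosyz J 0}) : shifts_to c' c -> cocycle c.
Proof.
move=> [u [_ uc]] x; apply: (@cor_in_inj J 0).
by rewrite -uc res_dd !linear0.
Qed.

Lemma zigzag_cocycle M i J (phi : {linear M -> cosyz J i})
    (c : {linear res M i -> cosyz J 0}) :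
  zigzag phi c -> cocycle c.
Proof.
case: i phi c => [|i] phi c /=; last by move=> [c' [_ /shifts_to_cocycle]].
by move=> pc x; rewrite pc free_eps_d linear0.
Qed.

Lemma zigzag_total M i J (phi : {linear M -> cosyz J i}) :
  exists c, zigzag phi c.
Proof.
elim: i J phi => [|i IHi] J phi; first by exists (phi \o @free_eps R M).
have [c' pc'] := IHi (shift J) phi.
have [u uc'] := lift_free c' (@cor_out_surj J 0).
have [x|c cP] := factor_injective (f := u \o res_d M i) (@cor_in_inj J 0).
  by apply/cor_outP; rewrite /= uc'; apply: zigzag_cocycle pc' x.
by exists c, c'; split=> //; exists u; split=> // x; rewrite cP.
Qed.

(** In positive degree a cocycle with values in an injective module is a
    coboundary. *)
Lemma shifts_to_surjective M J i (c : {linear res M i.+1 -> cosyz J 0}) :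
  cocycle c ->
  exists c' : {linear res M i -> cosyz J 1}, cocycle c' /\ shifts_to c' c.
Proof.
move=> cZ.
have [x /res_exact[y <-]|u uP] := injective_factor (d := res_d M i)
  (f := cor_in J 0 \o c) (@cor_inj R J 0).
  by rewrite /= cZ linear0.
exists (cor_out J 0 \o u); split; last by exists u.
by move=> x /=; rewrite uP /= cor_out_in.
Qed.

Lemma zigzag_surjective M i J (c : {linear res M i -> cosyz J 0}) :
  cocycle c -> exists phi : {linear M -> cosyz J i}, zigzag phi c.
Proof.
elim: i J c => [|i IHi] J c cZ.
  have [x /res_exact0[y <-]|phi phiP] :=
      factor_surjective (f := c) (@free_eps_surj R M).
    exact: cZ.
  by exists phi => x; rewrite phiP.
have [c' [c'Z c'c]] := shifts_to_surjective cZ.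
by have [phi pc'] := IHi (shift J) c' c'Z; exists phi, c'.
Qed.

(** Above degree 0 the hull has no cohomology, so the connecting map is injective
    there. *)
Lemma shifts_to_coboundary M J i (c' : {linear res M i.+1 -> cosyz J 1})
    (c : {linear res M i.+2 -> cosyz J 0}) :
  shifts_to c' c -> (coboundary c' <-> coboundary c).
Proof.
move=> [u [uc' uc]]; split=> [[v vP]|[v vP]].
  have [w wP] := lift_free v (@cor_out_surj J 0).
  pose u' : {linear res M i.+1 -> hull J 0} := u \- (w \o res_d M i).
  have [x|b bP] := factor_injective (f := u') (@cor_in_inj J 0).
    by apply/cor_outP; rewrite /= linearB uc' wP vP subrr.
  have {}bP x : cor_in J 0 (b x) = u x - w (res_d M i x) := bP x.
  exists b => x; apply: (@cor_in_inj J 0).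
  by rewrite bP -uc res_dd linear0 subr0.
pose u' : {linear res M i.+1 -> hull J 0} := u \- (cor_in J 0 \o v).
have [x /res_exact[y <-]|w wP] :=
    injective_factor (d := res_d M i) (f := u') (@cor_inj R J 0).
  by rewrite /= uc vP subrr.
exists (cor_out J 0 \o w) => x /=.
by rewrite wP /= linearB cor_out_in subr0 uc'.
Qed.

(** The first connecting map, out of Hom(M, cosyz i), has as kernel the maps that
    lift to the hull; the later ones are injective. *)
Lemma zigzag_coboundary M i J (phi : {linear M -> cosyz J i})
    (c : {linear res M i -> cosyz J 0}) :
  zigzag phi c -> (coboundary c <-> lifts_to_hull phi).
Proof.
elim: i J phi c => [|[|i] IHi] J phi c.
- move=> /= pc; split=> [c0 x|p0 x]; last by rewrite pc p0.
  by have [y <-] := free_eps_surj x; rewrite -pc c0.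
- move=> [c' [/= pc' [u [uc' uc]]]]; split=> [[v vP]|[psi psiP]].
    pose u' : {linear res M 0 -> hull J 0} := u \- (cor_in J 0 \o v).
    have [x /res_exact0[y <-]|psi psiP] :=
        factor_surjective (f := u') (@free_eps_surj R M).
      by rewrite /= uc vP subrr.
    exists psi => x; have [y <-] := free_eps_surj x.
    by rewrite psiP /= linearB cor_out_in subr0 uc' pc'.
  pose u' : {linear res M 0 -> hull J 0} := u \- (psi \o @free_eps R M).
  have [x|v vP] := factor_injective (f := u') (@cor_in_inj J 0).
    by apply/cor_outP; rewrite /= linearB uc' pc' psiP subrr.
  have {}vP x : cor_in J 0 (v x) = u x - psi (free_eps x) := vP x.
  exists v => x; apply: (@cor_in_inj J 0).
  by rewrite vP -uc free_eps_d linear0 subr0.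
move=> [c' [pc' c'c]].
by rewrite -(shifts_to_coboundary c'c); apply: (IHi (shift J)).
Qed.

Lemma zigzag_natural M N (f : {linear M -> N}) i J
    (phi : {linear N -> cosyz J i}) (psi : {linear M -> cosyz J i})
    (c : {linear res N i -> cosyz J 0}) (d : {linear res M i -> cosyz J 0}) :
    (forall x, psi x = phi (f x)) -> (forall x, d x = c (res_map f i x)) ->
  zigzag phi c -> zigzag psi d.
Proof.
elim: i J phi psi c d => [|i IHi] J phi psi c d pf dc /=.
  by move=> pc x; rewrite dc pc pf free_eps_map.
move=> [c' [pc' [u [uc' uc]]]]; exists (c' \o res_map f i); split.
  exact: (IHi (shift J)) pc'.
exists (u \o res_map f i); split=> x /=; first by rewrite uc'.
by rewrite res_map_d uc dc.
Qed.

End Coresolution.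

Section ExtClass.
Variables (R : comNzRingType) (X : lmodType R).
Implicit Types (M N Y : lmodType R).

Definition hom_of M Y (c : {linear M -> Y}) : hom M Y :=
  Subm (asboolT (linearP c) : (c : M -> Y) \in linears M Y).

Definition ext_class M i (c : {linear res M i -> X}) (y : ext M X i) :=
  exists cZ : hom_of c \in cocycles M X i,
    y = quo_in (premod (sub_in (cocycles M X i)) (coboundaries M X i)) (Subm cZ).

Lemma cocycleP M i (c : {linear res M i -> X}) :
  hom_of c \in cocycles M X i <-> cocycle c.
Proof.
split=> [/eqP c0 x|cZ]; first exact: (congr1 (fun h => hom_app h x) c0).
by apply/eqP/hom_ext => x; apply: cZ.
Qed.

Lemma coboundaryP M i (c : {linear res M i -> X}) :
  hom_of c \in coboundaries M X i <-> coboundary c.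
Proof.
case: i c => [|i] c /=; split.
- by move=> /span_set0 c0 x; apply: (congr1 (fun h => hom_app h x) c0).
- move=> c0; have -> : hom_of c = 0 by apply/hom_ext => x; apply: c0.
  exact: (rpred0 (span set0)).
- move=> /asboolP[v vc]; exists (hom_app v) => x.
  by rewrite -[c x]/(hom_app (hom_of c) x) -vc.
- move=> [v vc]; apply/asboolP; exists (hom_of v); apply/hom_ext => x.
  exact/esym/vc.
Qed.

Lemma ext_class_cocycle M i (c : {linear res M i -> X}) y :
  ext_class c y -> cocycle c.
Proof. by move=> [cZ _]; apply/cocycleP. Qed.

Lemma ext_class_exists M i (c : {linear res M i -> X}) :
  cocycle c -> exists y, ext_class c y.
Proof. by move=> /cocycleP cZ; eexists; exists cZ. Qed.

Lemma ext_class_surjective M i (y : ext M X i) :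
  exists c : {linear res M i -> X}, ext_class c y.
Proof.
have [[phi phiZ] <-] := quo_in_surj y.
have e : hom_of (hom_app phi : {linear _ -> _}) = phi by apply: hom_ext.
exists (hom_app phi); rewrite /ext_class e.
by exists phiZ.
Qed.

Lemma ext_class_eq0 M i (c : {linear res M i -> X}) y :
  ext_class c y -> (y = 0 <-> coboundary c).
Proof. by move=> [cZ ->]; rewrite -coboundaryP; apply: quo_in_eq0. Qed.

Lemma ext_class_linear M i (c c' c'' : {linear res M i -> X}) y y' r :
    (forall x, c'' x = r *: c x + c' x) ->
  ext_class c y -> ext_class c' y' -> ext_class c'' (r *: y + y').
Proof.
move=> cE [cZ ->] [c'Z ->].
have e : hom_of c'' = r *: hom_of c + hom_of c' by apply: hom_ext.
have c''Z : hom_of c'' \in cocycles M X i by rewrite e rpredD ?rpredZ.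
exists c''Z; rewrite -linearP; congr (quo_in _ _); apply: val_inj.
by rewrite /= e.
Qed.

Lemma ext_class_map M N (f : {linear M -> N}) i (c : {linear res N i -> X})
    (d : {linear res M i -> X}) y :
    (forall x, d x = c (res_map f i x)) ->
  ext_class c y -> ext_class d (ext_map X f i y).
Proof.
move=> dc [cZ ->].
have e : hom_of d = precomp X (res_map f i) (hom_of c) by apply: hom_ext.
have dZ : hom_of d \in cocycles M X i.
  by rewrite e; apply: cocycles_map_subproof.
exists dZ; rewrite /ext_map quo_mapE; congr (quo_in _ _); apply: val_inj.
by rewrite /= e.
Qed.

End ExtClass.

(** * Local cohomology classes as torsion maps *)

Section LocalCohomologyClass.
Variables (R : comNzRingType) (a : ideal R).
Implicit Types (M Y : lmodType R).

Definition kills k M Y (phi : {linear M -> Y}) :=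
  forall x, x \in mulmod (expideal a k) (full M) -> phi x = 0.

Definition torsion M Y (phi : {linear M -> Y}) := exists k, kills k phi.

Lemma kills_le k k' M Y (phi : {linear M -> Y}) :
  (k <= k')%N -> kills k phi -> kills k' phi.
Proof.
move=> /subnK <-; elim: (k' - k)%N => // m IHm /IHm {}IHm x.
by move=> /power_quo_proj_subproof; apply: IHm.
Qed.

Section Module.
Variables (M : lmodType R) (J : coresolution R) (i : nat).
Let f k := ext_map (cosyz J 0) (power_quo_proj a M k) i.

Definition lifts_torsion_at k : {linear M -> cosyz J i} -> Prop :=
  if i is j.+1 then fun phi =>
    exists psi : {linear M -> hull J j},
      kills k psi /\ forall x, phi x = cor_out J j (psi x)
  else fun phi => forall x, phi x = 0.

Definition lifts_torsion (phi : {linear M -> cosyz J i}) :=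
  exists k, lifts_torsion_at k phi.

(** A map that kills a^k M is a map out of M/a^k M, so the maps representing
    classes at all levels [k] live in the same Hom(M, cosyz i), and the transition
    maps of the direct limit leave the representing map unchanged
    ([level_class_step]). *)
Definition level_class k (phi : {linear M -> cosyz J i})
    (y : ext (power_quo a M k) (cosyz J 0) i) :=
  exists (phik : {linear power_quo a M k -> cosyz J i}) c,
    [/\ forall x, phi x = phik (quo_in _ x), zigzag phik c & ext_class c y].

Lemma level_class_step k phi (y : ext (power_quo a M k) (cosyz J 0) i) :
  level_class phi y -> level_class phi (f k y).
Proof.
move=> [phik [c [phiE pc cy]]].
exists (phik \o power_quo_proj a M k), (c \o res_map (power_quo_proj a M k) i).
split; first by move=> x; rewrite phiE; congr (phik _); rewrite [RHS]quo_mapE.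
  exact: zigzag_natural pc.
exact: ext_class_map cy.
Qed.

Lemma level_class_push k m phi (y : ext (power_quo a M k) (cosyz J 0) i) :
  level_class phi y -> level_class phi (push f m y).
Proof. by move=> py; elim: m => //= m IHm; apply: level_class_step. Qed.

Lemma level_class_total k (phi : {linear M -> cosyz J i}) :
  kills k phi ->
  exists y : ext (power_quo a M k) (cosyz J 0) i, level_class phi y.
Proof.
move=> kphi.
have [x /quo_in_eq0/kphi//|phik phikE] := factor_surjective (f := phi)
  (@quo_in_surj R M (mulmod (expideal a k) (full M))).
have [c pc] := zigzag_total phik.
have [y cy] := ext_class_exists (zigzag_cocycle pc).
by exists y, phik, c; split=> // x; rewrite phikE.
Qed.

Lemma level_class_surjective k (y : ext (power_quo a M k) (cosyz J 0) i) :
  exists phi, kills k phi /\ level_class phi y.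
Proof.
have [c cy] := ext_class_surjective y.
have [phik pc] := zigzag_surjective (ext_class_cocycle cy).
exists (phik \o quo_in _); split; last by exists phik, c.
by move=> x /quo_in_eq0 x0; rewrite /= x0 linear0.
Qed.

Lemma level_class_eq0 k phi (y : ext (power_quo a M k) (cosyz J 0) i) :
  level_class phi y -> (y = 0 <-> lifts_torsion_at k phi).
Proof.
move=> [phik [c [phiE pc cy]]].
rewrite (ext_class_eq0 cy) (zigzag_coboundary pc).
rewrite /lifts_torsion_at; clear f; move: phi phik phiE {y c pc cy}.
case: i => [|j] phi phik phiE /=; split.
- by move=> p0 x; rewrite phiE.
- by move=> p0 z; have [x <-] := quo_in_surj z; rewrite -phiE.
- move=> [psik psikE]; exists (psik \o quo_in _); split=> x.
    by move=> /quo_in_eq0 x0; rewrite /= x0 linear0.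
  by rewrite phiE psikE.
- move=> [psi [kpsi psiE]].
  have [x /quo_in_eq0/kpsi//|psik psikE] := factor_surjective (f := psi)
    (@quo_in_surj R M (mulmod (expideal a k) (full M))).
  by exists psik => z; have [x <-] := quo_in_surj z; rewrite -phiE psikE.
Qed.

Lemma level_class_linear k (phi phi' phi'' : {linear M -> cosyz J i}) r
    (y y' : ext (power_quo a M k) (cosyz J 0) i) :
    (forall x, phi'' x = r *: phi x + phi' x) ->
  level_class phi y -> level_class phi' y' -> level_class phi'' (r *: y + y').
Proof.
move=> pE [phik [c [phiE pc cy]]] [phik' [c' [phiE' pc' cy']]].
exists (r \*: phik \+ phik'), (r \*: c \+ c'); split.
- by move=> x; rewrite pE phiE phiE'.
- exact: zigzag_linear pc pc'.
- exact: ext_class_linear cy cy'.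
Qed.

Definition class_at k (phi : {linear M -> cosyz J i})
    (h : gen_local_cohomology a M (cosyz J 0) i) :=
  exists y : ext (power_quo a M k) (cosyz J 0) i,
    level_class phi y /\ h = colim_in f y.

Lemma class_at_le k k' phi h :
  (k <= k')%N -> class_at k phi h -> class_at k' phi h.
Proof.
move=> /subnK <-; elim: (k' - k)%N => // m IHm /IHm[y [py ->]].
exists (f _ y); split; first exact: level_class_step.
by rewrite colim_in_step.
Qed.

Definition coh_class phi h := exists k, class_at k phi h.

Lemma coh_class_total (phi : {linear M -> cosyz J i}) :
  torsion phi -> exists h, coh_class phi h.
Proof.
move=> [k /level_class_total[y py]]; exists (colim_in f y), k.
by exists y.
Qed.

Lemma coh_class_torsion phi h : coh_class phi h -> torsion phi.
Proof.
move=> [k [y [[phik [c [phiE _ _]]] _]]]; exists k => x /quo_in_eq0 x0.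
by rewrite phiE x0 linear0.
Qed.

Lemma coh_class_surjective h : exists phi, torsion phi /\ coh_class phi h.
Proof.
have [k [y <-]] := colim_in_surj (f := f) h.
have [phi [kphi py]] := level_class_surjective y.
by exists phi; split; [exists k|exists k, y].
Qed.

Lemma lifts_torsion_at_le k k' (phi : {linear M -> cosyz J i}) :
  (k <= k')%N -> lifts_torsion_at k phi -> lifts_torsion_at k' phi.
Proof.
rewrite /lifts_torsion_at; case: i phi => // j phi kk' [psi [kpsi psiE]].
by exists psi; split=> //; apply: kills_le kpsi.
Qed.

(** A class is 0 in the limit once it is 0 at some level, where
    [zigzag_coboundary] applies. *)
Lemma coh_class_eq0 phi h : coh_class phi h -> (h = 0 <-> lifts_torsion phi).
Proof.
move=> [k pk]; split=> [h0|[k' pk']].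
  have [y [py hy]] := pk; have [m ym] : exists m, push f m y = 0.
    by apply/colim_in_eq0; rewrite -hy.
  by exists (m + k)%N; apply/(level_class_eq0 (level_class_push m py)).
have [y [py ->]] := class_at_le (leq_maxl k k') pk.
suff -> : y = 0 by rewrite linear0.
exact/(level_class_eq0 py)/(lifts_torsion_at_le (leq_maxr k k')).
Qed.

Lemma coh_class_linear (phi phi' phi'' : {linear M -> cosyz J i}) h h' r :
    (forall x, phi'' x = r *: phi x + phi' x) ->
  coh_class phi h -> coh_class phi' h' -> coh_class phi'' (r *: h + h').
Proof.
move=> pE [k pk] [k' pk'].
have [y [py ->]] := class_at_le (leq_maxl k k') pk.
have [y' [py' ->]] := class_at_le (leq_maxr k k') pk'.
exists (maxn k k'), (r *: y + y'); split; last by rewrite linearP.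
exact: level_class_linear py py'.
Qed.

End Module.
End LocalCohomologyClass.

(** * Noetherian modules and the Artin-Rees lemma *)

Section Noetherian.
Variables (R : comNzRingType) (V : lmodType R).

Lemma span_subset (A B : set V) :
  (forall x, A x -> B x) -> {subset span A <= span B}.
Proof. by move=> AB x; apply: span_sub => y /AB; apply: mem_span. Qed.

Lemma span_cons (x : V) (s : seq V) y :
  y \in span [set` x :: s]%classic ->
  exists r, y - r *: x \in span [set` s]%classic.
Proof.
have Usub : submod_closed (fun y => `[< exists r : R,
    y - r *: x \in span [set` s]%classic >]).
  split.
    apply/asboolP; exists 0; rewrite scale0r subr0; exact: (rpred0 (span _)).
  move=> c y1 y2 /asboolP[r1 h1] /asboolP[r2 h2]; apply/asboolP.
  exists (c * r1 + r2); rewrite scalerDl -scalerA opprD addrACA -scalerBr.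
  by rewrite rpredD ?rpredZ.
move=> /(span_sub (U := Submodule Usub)) H; apply/asboolP/H => z.
rewrite /mkset inE => /orP[/eqP ->|zs]; apply/asboolP.
  by exists 1; rewrite scale1r subrr; exact: (rpred0 (span _)).
by exists 0; rewrite scale0r subr0; apply: mem_span.
Qed.

Definition noetherian_module := forall U : submodule V,
  exists s : seq V, U =i span [set` s]%classic.

Lemma ascending_chain (C : nat -> submodule V) : noetherian_module ->
    (forall k, {subset C k <= C k.+1}) ->
  exists n, forall k, {subset C k <= C n}.
Proof.
move=> noethV Cinc.
have Cle k k' : (k <= k')%N -> {subset C k <= C k'}.
  by move=> /subnK <-; elim: (k' - k)%N => // m IHm x /IHm/Cinc.
have Usub : submod_closed (fun x => `[< exists k, x \in C k >]).
  split; first by apply/asboolP; exists 0%N; rewrite rpred0.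
  move=> r x y /asboolP[k xk] /asboolP[k' yk']; apply/asboolP; exists (maxn k k').
  rewrite rpredD ?rpredZ //.
    exact: Cle (leq_maxl _ _) _ xk.
  exact: Cle (leq_maxr _ _) _ yk'.
have [s sP] := noethV (Submodule Usub).
have [n sn] : exists n, forall x, x \in s -> x \in C n.
  have : forall x, x \in s -> exists k, x \in C k.
    move=> x xs; apply/asboolP.
    by rewrite -[asbool _]/(x \in Submodule Usub) sP mem_span.
  elim: s {sP} => [|x s IHs] sC; first by exists 0%N.
  have [k xk] := sC x (mem_head _ _).
  have [|k' sk'] := IHs; first by move=> y ys; apply: sC; rewrite inE ys orbT.
  exists (maxn k k') => y; rewrite inE => /orP[/eqP ->|/sk'].
    exact/Cle/xk/leq_maxl.
  exact/Cle/leq_maxr.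
exists n => k x xk; apply: (span_sub (A := [set` s]%classic)) => //.
by rewrite -sP; apply/asboolP; exists k.
Qed.

(** Hilbert's argument, by induction on the generators [x :: s]: the coefficients
    of [x] in elements of [U] form an ideal; lifts to [U] of its generators [rs],
    together with generators of the part of [U] inside the span of [s], generate
    [U]. *)
Lemma noetherian_fg : noetherian R -> finitely_generated V -> noetherian_module.
Proof.
move=> noethR [s0 s0P] U0.
suff : forall (s : seq V) (U : submodule V),
    {subset U <= span [set` s]%classic} ->
    exists t : seq V, U =i span [set` t]%classic.
  by move=> fg; apply: (fg s0) => x _; rewrite -s0P.
elim=> [|x s IHs] U Us.
  exists [::] => y; apply/idP/idP => [/Us//|].
  by apply: span_sub => z.
have Lsub (T : submodule V) : submod_closed (fun r : R^o => `[< exists u,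
    u \in T /\ u - r *: x \in span [set` s]%classic >]).
  split; first by apply/asboolP; exists 0; rewrite scale0r subr0 !rpred0.
  move=> c r1 r2 /asboolP[u1 [T1 h1]] /asboolP[u2 [T2 h2]]; apply/asboolP.
  exists (c *: u1 + u2); split; first by rewrite rpredD ?rpredZ.
  rewrite scalerDl -[c *: r1]/(c * r1) -scalerA opprD addrACA -scalerBr.
  by rewrite rpredD ?rpredZ.
pose L T : ideal R := Submodule (Lsub T).
have [rs rsP] := noethR (L U).
have /choice[u uP] : forall r : R, exists v, r \in rs ->
    v \in U /\ v - r *: x \in span [set` s]%classic.
  move=> r; have [rrs|] := boolP (r \in rs); last by exists 0.
  have : r \in L U by rewrite rsP mem_span.
  by move=> /asboolP[v vP]; exists v.
have Wsub : submod_closed (fun v => (v \in U) && (v \in span [set` s]%classic)).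
  split; first by rewrite unfold_in !rpred0.
  move=> r y z /andP[yU ys] /andP[zU zs].
  by rewrite unfold_in !rpredD ?rpredZ.
have [|t tP] := IHs (Submodule Wsub); first by move=> y /andP[].
exists (map u rs ++ t) => y; set T := span _.
have tT : {subset span [set` t]%classic <= T}.
  by apply: span_subset => z /= zt; rewrite mem_cat zt orbT.
have TU : {subset T <= U}.
  move=> z; apply: span_sub => v /=; rewrite mem_cat => /orP[/mapP[r rrs ->]|vt].
    by have [] := uP r rrs.
  have : v \in span [set` t]%classic by apply: mem_span.
  by rewrite -tP => /andP[].
apply/idP/idP => [yU|/TU//].
have [r yr] := span_cons (Us y yU).
have : r \in L U by apply/asboolP; exists y.
rewrite rsP => /(span_sub (U := L T)).
case/(_ _)/asboolP=> [r' /= r'rs|v [vT vr]].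
  apply/asboolP; exists (u r'); have [_ ur'] := uP r' r'rs; split=> //.
  by apply: mem_span => /=; rewrite mem_cat map_f.
rewrite -[y](subrK v) rpredD //; apply: tT; rewrite -tP; apply/andP; split.
  by rewrite rpredB // TU.
have -> : y - v = (y - r *: x) - (v - r *: x) by rewrite opprB addrA subrK.
exact: rpredB.
Qed.

End Noetherian.

Lemma submod_lin (R : comNzRingType) (V : lmodType R) (U : submodule V) r x y :
  x \in U -> y \in U -> r *: x + y \in U.
Proof. by move=> xU yU; rewrite rpredD ?rpredZ. Qed.

Section ArtinRees.
Variables (R : comNzRingType) (a : ideal R) (V : lmodType R).

Lemma expideal_exp r k : r \in a -> (r ^+ k : R) \in expideal a k.
Proof.
move=> ra; elim: k => [|k IHk] //=; apply: mem_span.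
by exists r, (r ^+ k); rewrite exprS.
Qed.

(** If each generator [r] of [a] has a power that sends [V] into [L], then so has
    [a].  Multiplying by one generator [r] amounts to replacing [L] by the
    submodule of the [v] with [r v] in [L], for which the exponent of [r] drops by
    one; hence the induction on the sum of the exponents. *)
Lemma expideal_scale_sub (s : seq R^o) : a =i span [set` s]%classic ->
  forall n (k : R -> nat) (L : submodule V),
    (forall r : R, r \in s -> forall v, r ^+ k r *: v \in L) ->
    (\sum_(r <- s) k r < n)%N ->
  forall (z : R) v, z \in expideal a n -> z *: v \in L.
Proof.
move=> sP; elim=> [//|n IHn] k L sL ltk z v zP.
have key (r y : R) w : r \in s -> y \in expideal a n -> (r * y) *: w \in L.
  move=> rs yn.
  have [kr0|kr] := posnP (k r).
    by have := sL r rs ((r * y) *: w); rewrite kr0 expr0 scale1r.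
  have L'sub : submod_closed (fun v => r *: v \in L).
    split; first by rewrite unfold_in scaler0; exact: (rpred0 L).
    move=> c v1 v2 h1 h2; rewrite unfold_in scalerDr scalerA mulrC -scalerA.
    exact: submod_lin.
  suff : y *: w \in Submodule L'sub by rewrite unfold_in /= scalerA.
  pose k' r' := if r' == r then (k r).-1 else k r'.
  apply: (IHn k') => //.
    move=> r' r's u; rewrite unfold_in /= /k'; case: eqP => [->|_].
      by rewrite scalerA -exprS prednK // sL.
    by rewrite scalerA mulrC -scalerA sL.
  apply: leq_trans (_ : \sum_(r <- s) k r <= n)%N; last by rewrite -ltnS.
  rewrite !(perm_big _ (perm_to_rem rs)) !big_cons {1}/k' eqxx.
  rewrite -addSn prednK // leq_add2l leq_sum // => r' _.
  by rewrite /k'; case: eqP => // ->; apply: leq_pred.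
have Psub : submod_closed (fun z : R^o => `[< forall v, (z : R) *: v \in L >]).
  split; first by apply/asboolP => w; rewrite scale0r rpred0.
  move=> c y1 y2 /asboolP h1 /asboolP h2; apply/asboolP => w.
  by rewrite scalerDl -[c *: y1]/(c * y1) -scalerA; apply: submod_lin.
suff : z \in Submodule Psub by move=> /asboolP.
apply: (span_sub _ zP) => _ [r [y [ra yn ->]]]; apply/asboolP => w.
have Qsub : submod_closed (fun r : R^o => `[< (r * y : R) *: w \in L >]).
  split; first by apply/asboolP; rewrite mul0r scale0r rpred0.
  move=> c y1 y2 /asboolP h1 /asboolP h2; apply/asboolP.
  by rewrite mulrDl scalerDl -[c *: y1]/(c * y1) -mulrA -scalerA; apply: submod_lin.
suff : r \in Submodule Qsub by move=> /asboolP.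
by move: ra; rewrite sP; apply: span_sub => r' r's; apply/asboolP/key.
Qed.

(** Take [L] containing [N] maximal with the intersection of [L] and [K] inside
    [N].  For [r] in [a] the submodules of the [v] with [r^k v] in [L] stabilise,
    and for k large the submodule L + r^k V still meets [K] inside [N]: if
    y = l + r^k v lies in [K], then [r^k y] lies in [N], so [r^(2k) v] lies in
    [L], so [r^k v] lies in [L] already.  By maximality r^k V is contained in [L]
    for every [r] in [a], and [a] is finitely generated. *)
Lemma weak_artin_rees (K N : submodule V) m :
    noetherian R -> noetherian_module V ->
    (forall (r : R) x, r \in expideal a m -> x \in K -> r *: x \in N) ->
  exists l, forall x, x \in mulmod (expideal a l) (full V) -> x \in K -> x \in N.
Proof.
move=> noethR noethV aKN.
pose op r (x y : V) := r *: x + y.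
have [r x y|x xN [_ /negP]//|L0 [L0op NL0 L0A L0max]] := @maximal_closed V R op
  (fun x => x \in N) (fun x => x \in K /\ x \notin N).
  by move=> xN yN; rewrite rpredD ?rpredZ.
have Lsub : submod_closed (fun x => `[< L0 x >]).
  split; first by apply/asboolP/NL0; rewrite rpred0.
  by move=> r x y /asboolP xL /asboolP yL; apply/asboolP/L0op.
have [L LE] : exists L : submodule V, forall x, x \in L <-> L0 x.
  by exists (Submodule Lsub) => x; split=> [/asboolP|xL]; last apply/asboolP.
have LK x : x \in L -> x \in K -> x \in N.
  by move=> /LE/L0A xA xK; apply/negPn/negP => xN; apply: xA.
have NL x : x \in N -> x \in L by move=> /NL0/LE.
have power (r : R) : r \in a -> exists k, forall v, r ^+ k *: v \in L.
  move=> ra.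
  have Csub k : submod_closed (fun v => r ^+ k *: v \in L).
    split; first by rewrite unfold_in scaler0; exact: (rpred0 L).
    move=> c v1 v2 h1 h2; rewrite unfold_in scalerDr scalerA mulrC -scalerA.
    exact: submod_lin.
  have [|n nP] := ascending_chain (C := fun k => Submodule (Csub k)) noethV.
    by move=> k x xk; rewrite unfold_in /= exprS -scalerA; apply: (@rpredZ _ _ L).
  (* Stabilisation needs k >= n, and k >= m puts r ^ k in the m-th power of a. *)
  pose k := (n + m)%N; exists k.
  have L'op : closed_under op (fun y => exists v, y - r ^+ k *: v \in L).
    move=> c y1 y2 [v1 h1] [v2 h2]; exists (c *: v1 + v2).
    rewrite scalerDr opprD addrACA scalerA mulrC -scalerA -scalerBr.
    exact: submod_lin.
  move=> v; apply/LE; apply: (L0max _ L'op).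
  - by move=> x xL; exists 0; rewrite scaler0 subr0; apply/LE.
  - move=> y [w yw] [yK /negP]; apply.
    have ry : r ^+ k *: y \in L.
      by apply: NL; rewrite /k exprD -scalerA rpredZ // aKN // expideal_exp.
    have : w \in Submodule (Csub (k + k)%N).
      rewrite unfold_in /= exprD -scalerA -[_ *: w](subKr y) scalerBr.
      by rewrite rpredB // rpredZ.
    move=> /nP wn; apply: LK => //; rewrite -[y](subrK (r ^+ k *: w)) rpredD //.
    by rewrite /k addnC exprD -scalerA rpredZ.
  - by exists v; rewrite subrr rpred0.
have [s sP] := noethR a.
have /choice[k kP] : forall r : R, exists k, r \in s -> forall v, r ^+ k *: v \in L.
  move=> r; have [rs|] := boolP (r \in s); last by exists 0%N.
  by have [|k kP] := power r; [rewrite sP mem_span|exists k].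
exists (\sum_(r <- s) k r).+1 => x xl; apply: LK; apply: (span_sub _ xl).
move=> _ [r [y [rl _ ->]]].
exact: (expideal_scale_sub sP kP (ltnSn _)).
Qed.

End ArtinRees.

(** Weak Artin-Rees with [N] the kernel of [phi] bounds the kernel of
    U -> F/a^l F, so [phi] factors through its image and extends to F/a^l F. *)
Lemma torsion_extension (R : comNzRingType) (a : ideal R) (F E : lmodType R)
    (U : submodule F) (phi : {linear subm U -> E}) :
    noetherian R -> finitely_generated F -> injective_module E -> torsion a phi ->
  exists psi : {linear F -> E},
    torsion a psi /\ forall x, psi (sub_in U x) = phi x.
Proof.
move=> noethR fgF injE [m mphi].
have Nsub : submod_closed (fun x => `[< exists u : subm U,
    sub_in U u = x /\ phi u = 0 >]).
  split; first by apply/asboolP; exists 0; rewrite !linear0.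
  move=> r _ _ /asboolP[u [<- u0]] /asboolP[v [<- v0]]; apply/asboolP.
  by exists (r *: u + v); rewrite !linearP u0 v0 scaler0 addr0.
have noethF := noetherian_fg noethR fgF.
have [|l lP] := @weak_artin_rees R a F U (Submodule Nsub) m noethR noethF.
  move=> r x rm xU; pose u : subm U := Subm xU; apply/asboolP; exists (r *: u).
  by split=> //; apply: mphi; apply: mem_span; exists r, u.
pose q := quo_in (mulmod (expideal a l) (full F)).
have [x /quo_in_eq0 xl|psi psiE] := injective_factor (d := q \o sub_in U)
    (f := phi) injE.
  have /asboolP[u [/val_inj <-]] := lP _ xl (valP x).
  by [].
exists (psi \o q); split; last by move=> x; rewrite -psiE.
by exists l => x /quo_in_eq0 x0; rewrite /= x0 linear0.
Qed.

(** * Exact sequences for local cohomology *)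

Section Torsion.
Variables (R : comNzRingType) (a : ideal R).
Implicit Types (M N Y : lmodType R) (J : coresolution R).

Lemma mulmod_map (I : ideal R) M N (f : {linear M -> N}) x :
  x \in mulmod I (full M) -> f x \in mulmod I (full N).
Proof.
move=> xI; apply: (span_sub (U := premod f (mulmod I (full N))) _ xI).
move=> _ [r [y [rI _ ->]]]; rewrite unfold_in /= linearZ.
by apply: mem_span; exists r, (f y).
Qed.

Lemma torsion_comp M N Y (f : {linear M -> N}) (phi : {linear N -> Y}) :
  torsion a phi -> torsion a (phi \o f).
Proof. by move=> [k kphi]; exists k => x /(mulmod_map f)/kphi. Qed.

Lemma torsion_descend M N Y (g : {linear M -> N}) (phi : {linear M -> Y})
    (psi : {linear N -> Y}) :
    (forall y, exists x, g x = y) -> (forall x, psi (g x) = phi x) ->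
  torsion a phi -> torsion a psi.
Proof.
move=> gsurj psig [k kphi]; exists k => z zk.
apply/eqP; apply: (span_sub (U := kermod psi) _ zk) => _ [r [y [rk _ ->]]].
apply/eqP; have [x <-] := gsurj y; rewrite -linearZ psig kphi //.
by apply: mem_span; exists r, x.
Qed.

Lemma torsion_linear M Y (phi phi' phi'' : {linear M -> Y}) r :
    (forall x, phi'' x = r *: phi x + phi' x) ->
  torsion a phi -> torsion a phi' -> torsion a phi''.
Proof.
move=> pE [k kphi] [k' kphi']; exists (maxn k k') => x xk.
rewrite pE (kills_le (leq_maxl k k') kphi) //.
by rewrite (kills_le (leq_maxr k k') kphi') // scaler0 addr0.
Qed.

Lemma lifts_torsion_torsion M J i (phi : {linear M -> cosyz J i}) :
  lifts_torsion a phi -> torsion a phi.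
Proof.
move=> [k]; rewrite /lifts_torsion_at; case: i phi => [|i] phi.
  by move=> p0; exists k => x _; apply: p0.
move=> [psi [kpsi psiE]]; exists k => x /kpsi psi0.
by rewrite psiE psi0 linear0.
Qed.

Lemma lifts_torsion_comp M N J i (f : {linear M -> N})
    (phi : {linear N -> cosyz J i}) :
  lifts_torsion a phi -> lifts_torsion a (phi \o f : {linear M -> cosyz J i}).
Proof.
move=> [k pk]; exists k; move: pk; rewrite /lifts_torsion_at.
case: i phi => [|i] phi; first by move=> p0 x; apply: p0.
move=> [psi [kpsi psiE]]; exists (psi \o f); split.
  by move=> x /(mulmod_map f)/kpsi.
by move=> x /=; rewrite psiE.
Qed.

Lemma coh_class0 M J i (phi : {linear M -> cosyz J i}) :
  (forall x, phi x = 0) -> @coh_class R a M J i phi 0.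
Proof.
move=> p0; have ephi : lifts_torsion a phi.
  exists 0%N; rewrite /lifts_torsion_at; case: i phi p0 => // i phi p0.
  by exists \0; split=> // x; rewrite p0 linear0.
have [h ph] := coh_class_total (lifts_torsion_torsion ephi).
by rewrite -((coh_class_eq0 ph).2 ephi).
Qed.

End Torsion.

Section ExactSequences.
Variables (R : comNzRingType) (a : ideal R) (S : lmodType R -> Prop).
Hypotheses (noethR : noetherian R) (serreS : serre_subcategory S).
Variable J : coresolution R.
Let H M i := gen_local_cohomology a M (cosyz J 0) i.

Variables (F M : lmodType R) (U : submodule F) (g : {linear F -> M}).
Hypotheses (fgF : finitely_generated F) (gsurj : forall y, exists x, g x = y).
Hypothesis gker : forall x, g x = 0 <-> x \in U.

Lemma descend (Y : lmodType R) (psi : {linear F -> Y}) :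
    (forall u, psi (sub_in U u) = 0) -> torsion a psi ->
  exists psi' : {linear M -> Y}, torsion a psi' /\ forall x, psi' (g x) = psi x.
Proof.
move=> psiU tpsi.
have [x /gker xU|psi' psi'E] := factor_surjective (f := psi) gsurj.
  exact: (psiU (Subm xU)).
by exists psi'; split=> //; apply: torsion_descend tpsi.
Qed.

Lemma quotient_map_sub_in u : g (sub_in U u) = 0.
Proof. exact/gker/(valP u). Qed.

(** A representative of the zero class on [U] extends to a representative of the
    zero class on [F]: extend its lift to the hull. *)
Lemma lifts_torsion_extension i (alpha : {linear subm U -> cosyz J i}) :
  lifts_torsion a alpha -> exists alpha' : {linear F -> cosyz J i},
    lifts_torsion a alpha' /\ forall u, alpha' (sub_in U u) = alpha u.
Proof.
rewrite /lifts_torsion /lifts_torsion_at.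
case: i alpha => [|i] alpha [k].
  by move=> alpha0; exists \0; split; [exists 0%N|move=> u; rewrite alpha0].
move=> [beta [kbeta betaE]].
have [|beta' [[l lbeta'] beta'E]] := torsion_extension noethR fgF
    (@cor_inj R J i) (phi := beta) (a := a); first by exists k.
exists (cor_out J i \o beta'); split; first by exists l, beta'.
by move=> u; rewrite betaE -beta'E.
Qed.

Lemma coh_pullback_rel i : linear_rel (fun (w : H M i) (v : H F i) =>
  exists gamma : {linear M -> cosyz J i},
    coh_class gamma w /\ coh_class (gamma \o g : {linear F -> cosyz J i}) v).
Proof.
split; first by exists \0; split; apply: coh_class0.
move=> r w w' v v' [c [cw cv]] [c' [cw' cv']]; exists (r \*: c \+ c').
by split; [exact: coh_class_linear cw cw'|exact: coh_class_linear cv cv'].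
Qed.

Lemma coh_pullback_total i (w : H M i) : exists (v : H F i)
    (gamma : {linear M -> cosyz J i}),
  coh_class gamma w /\ coh_class (gamma \o g : {linear F -> cosyz J i}) v.
Proof.
have [gamma [tgamma cw]] := coh_class_surjective w.
have [v cv] := coh_class_total (torsion_comp g tgamma).
by exists v, gamma.
Qed.

(** H^0 is left exact. *)
Lemma serre_quotient_deg0 : S (H F 0) -> S (H M 0).
Proof.
apply: (serre_subquotient serreS (D := fun v w =>
  exists gamma : {linear M -> cosyz J 0},
    coh_class gamma w /\ coh_class (gamma \o g : {linear F -> cosyz J 0}) v)).
- have [D0 Dlin] := coh_pullback_rel 0; split=> // r v v' w w'; exact: Dlin.
- move=> w [gamma [cw /coh_class_eq0[/(_ erefl)[k /= g0] _]]].
  apply/(coh_class_eq0 cw); exists 0%N => y; have [x <-] := gsurj y; exact: g0.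
- exact: coh_pullback_total.
Qed.

(** Exactness of H^i(U) -> H^{i+1}(M) -> H^{i+1}(F).  If [gamma] becomes trivial
    on [F] through a lift [psi] to the hull, then [psi] maps [U] into cosyz i, and
    its restriction [alpha] to [U] is the class that the connecting map sends to
    [gamma]. *)
Lemma serre_quotient_degS i : S (H (subm U) i) -> S (H F i.+1) -> S (H M i.+1).
Proof.
apply: (serre_exact serreS (D1 := fun v w =>
  exists (alpha : {linear subm U -> cosyz J i}) (psi : {linear F -> hull J i})
    (gamma : {linear M -> cosyz J i.+1}),
    [/\ coh_class alpha v, coh_class gamma w, torsion a psi,
        forall u, psi (sub_in U u) = cor_in J i (alpha u) &
        forall x, gamma (g x) = cor_out J i (psi x)]) (D2 := fun w v =>
  exists gamma : {linear M -> cosyz J i.+1},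
    coh_class gamma w /\ coh_class (gamma \o g : {linear F -> cosyz J i.+1}) v)).
- split.
    exists \0, \0, \0; split; [exact: coh_class0|exact: coh_class0| | |].
    - by exists 0%N.
    - by move=> u; rewrite linear0.
    - by move=> x; rewrite linear0.
  move=> r v v' w w' [al [ps [ga [av gw tp pa gp]]]].
  move=> [al' [ps' [ga' [av' gw' tp' pa' gp']]]].
  exists (r \*: al \+ al'), (r \*: ps \+ ps'), (r \*: ga \+ ga'); split.
  + exact: coh_class_linear av av'.
  + exact: coh_class_linear gw gw'.
  + exact: torsion_linear tp tp'.
  + by move=> u /=; rewrite pa pa' linearP.
  + by move=> x /=; rewrite gp gp' linearP.
- move=> w [alpha [psi [gamma [/coh_class_eq0[/(_ erefl) ealpha _] gw tpsi pa gp]]]].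
  have [alpha' [ealpha' alpha'E]] := lifts_torsion_extension ealpha.
  (* A trivial alpha extends to F; correcting psi by the extension makes the lift
     of gamma vanish on U. *)
  pose psi1 : {linear F -> hull J i} := (-1) \*: (cor_in J i \o alpha') \+ psi.
  have [||psi' [[k kpsi'] psi'E]] := descend (psi := psi1).
  + by move=> u; rewrite /= scaleN1r alpha'E pa addNr.
  + apply: (@torsion_linear _ _ _ _ (cor_in J i \o alpha') psi psi1 (-1)) => //.
    have [l lal] := lifts_torsion_torsion ealpha'.
    by exists l => x /lal /= ->; rewrite linear0.
  + apply/(coh_class_eq0 gw); exists k, psi'; split=> // y.
    have [x <-] := gsurj y; rewrite gp psi'E /= linearD linearZ /=.
    by rewrite cor_out_in scaler0 add0r.
- exact: coh_pullback_rel.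
- exact: coh_pullback_total.
- move=> w [gamma [gw /coh_class_eq0[/(_ erefl)[k [psi [kpsi psiE]]] _]]].
  have [u|alpha alphaE] :=
      factor_injective (f := psi \o sub_in U) (@cor_in_inj R J i).
    by apply/cor_outP; rewrite /= -psiE /= quotient_map_sub_in linear0.
  have tal : torsion a alpha.
    exists k => u /(mulmod_map (sub_in U))/kpsi psi0.
    by apply: (@cor_in_inj R J i); rewrite alphaE /= psi0 linear0.
  have [v cv] := coh_class_total tal; exists v, alpha, psi, gamma; split=> //.
  by exists k.
Qed.

(** Exactness of H^i(M) -> H^i(F) -> H^i(U): a class on [F] that is trivial on [U]
    has a representative that vanishes on [U], by [lifts_torsion_extension]. *)
Lemma serre_middle i : S (H M i) -> S (H (subm U) i) -> S (H F i).
Proof.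
apply: (serre_exact serreS (D1 := fun v w =>
  exists gamma : {linear M -> cosyz J i},
    coh_class gamma v /\ coh_class (gamma \o g : {linear F -> cosyz J i}) w)
  (D2 := fun w v => exists phi : {linear F -> cosyz J i},
    coh_class phi w /\
    coh_class (phi \o sub_in U : {linear subm U -> cosyz J i}) v)).
- exact: coh_pullback_rel.
- move=> w [gamma [/coh_class_eq0[/(_ erefl) egamma _] cw]].
  exact/(coh_class_eq0 cw)/lifts_torsion_comp.
- split; first by exists \0; split; apply: coh_class0.
  move=> r w w' v v' [c [cw cv]] [c' [cw' cv']]; exists (r \*: c \+ c').
  by split; [exact: coh_class_linear cw cw'|exact: coh_class_linear cv cv'].
- move=> w; have [phi [tphi cw]] := coh_class_surjective w.
  by have [v cv] := coh_class_total (torsion_comp (sub_in U) tphi); exists v, phi.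
- move=> w [phi [cw /coh_class_eq0[/(_ erefl) ephi _]]].
  have [alpha [ealpha alphaE]] := lifts_torsion_extension ephi.
  pose phi1 : {linear F -> cosyz J i} := (-1) \*: alpha \+ phi.
  have cal : coh_class alpha (0 : H F i).
    have [h ch] := coh_class_total (lifts_torsion_torsion ealpha).
    by rewrite -((coh_class_eq0 ch).2 ealpha).
  have cphi1 : coh_class phi1 w.
    have := @coh_class_linear _ _ _ _ _ alpha phi phi1 _ _ (-1) _ cal cw.
    by rewrite scaler0 add0r; apply.
  have [||gamma [tgamma gammaE]] := descend (psi := phi1).
  + by move=> u; rewrite /= scaleN1r alphaE addNr.
  + apply: (torsion_linear (r := -1)) (lifts_torsion_torsion ealpha)
      (coh_class_torsion cw) => //.
  have [v cv] := coh_class_total tgamma; exists v, gamma; split=> //.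
  have cg : coh_class (gamma \o g : {linear F -> cosyz J i}) (1 *: w + 0).
    apply: (coh_class_linear (phi' := \0) _ cphi1); last exact: coh_class0.
    by move=> x; rewrite /= gammaE scale1r addr0.
  by rewrite scale1r addr0 in cg.
Qed.

End ExactSequences.

(** * Induction on degree and generators *)

Lemma lift_seq (R : comNzRingType) (V : lmodType R) (U : submodule V)
    (s : seq V) :
  {subset s <= U} -> exists t : seq (subm U), map (sub_in U) t = s.
Proof.
elim: s => [|x s IHs] sU; first by exists [::].
have [|t tE] := IHs; first by move=> y ys; apply: sU; rewrite inE ys orbT.
by exists (Subm (sU x (mem_head _ _)) :: t); rewrite /= tE.
Qed.

Definition generated_by (R : comNzRingType) (V : lmodType R) n :=
  exists s : seq V, size s = n /\ full V =i span [set` s]%classic.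

Lemma generated_subm (R : comNzRingType) (V : lmodType R) (U : submodule V)
    (s : seq V) :
  U =i span [set` s]%classic -> generated_by (subm U) (size s).
Proof.
move=> sP; have [|t tE] := @lift_seq _ _ U s.
  by move=> x xs; rewrite sP; apply: mem_span.
exists t; split; first by rewrite -tE size_map.
move=> u; apply/esym; have Isub : submod_closed (fun x => `[< exists v,
    v \in span [set` t]%classic /\ sub_in U v = x >]).
  split; first by apply/asboolP; exists 0; rewrite linear0 rpred0.
  move=> r _ _ /asboolP[v [vt <-]] /asboolP[w [wt <-]]; apply/asboolP.
  by exists (r *: v + w); rewrite linearP rpredD ?rpredZ.
suff /asboolP[v [vt /sub_in_inj <-]] : sub_in U u \in Submodule Isub by [].
have := valP u; rewrite sP; apply: span_sub => x; rewrite /mkset -tE.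
by move=> /mapP[v vt ->]; apply/asboolP; exists v; split=> //; apply: mem_span.
Qed.

Lemma finitely_generated_subm (R : comNzRingType) (V : lmodType R)
    (U : submodule V) :
  noetherian R -> finitely_generated V -> finitely_generated (subm U).
Proof.
move=> noethR fgV; have [s sP] := noetherian_fg noethR fgV U.
by have [t [_ tP]] := generated_subm sP; exists t.
Qed.

Lemma finitely_generated_ring (R : comNzRingType) :
  finitely_generated (R^o : lmodType R).
Proof.
exists [:: 1 : R^o] => r; apply/esym.
rewrite -[r]mulr1 -[r * 1]/(r *: (1 : R^o)); apply: rpredZ.
by apply: mem_span; rewrite /mkset inE.
Qed.

Section MainInduction.
Variables (R : comNzRingType) (a : ideal R) (S : lmodType R -> Prop).
Hypotheses (noethR : noetherian R) (serreS : serre_subcategory S).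
Variable J : coresolution R.
Let X := cosyz J 0.

Lemma serre_cyclic i (M : lmodType R) (z : M) :
    (forall N, finitely_generated N -> forall j, (j < i)%N ->
       S (gen_local_cohomology a N X j)) ->
    S (local_cohomology a X i) -> (forall y, exists r : R, r *: z = y) ->
  S (gen_local_cohomology a M X i).
Proof.
move=> IH SR zP.
have gl : linear (fun r : R^o => (r : R) *: z).
  by move=> r x y; rewrite scalerDl -[r *: x]/(r * x) scalerA.
pose g := mk_linear gl.
have gsurj y : exists x, g x = y by have [r rz] := zP y; exists r.
have gker x : g x = 0 <-> x \in kermod g by split=> /eqP.
have fgR := finitely_generated_ring R.
case: i IH SR => [|i] IH SR; first exact: (serre_quotient_deg0 serreS gsurj).
apply: (serre_quotient_degS noethR serreS fgR gsurj gker) SR.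
by apply: IH => //; apply: finitely_generated_subm.
Qed.

Lemma serre_finitely_generated n :
  (forall i, (i <= n)%N -> S (local_cohomology a X i)) ->
  forall M, finitely_generated M -> S (gen_local_cohomology a M X n).
Proof.
elim/ltn_ind: n => n IHn SR.
have IH N : finitely_generated N -> forall j, (j < n)%N ->
    S (gen_local_cohomology a N X j).
  move=> fgN j jn; apply: IHn => // i ij; apply: SR.
  exact: leq_trans ij (ltnW jn).
suff gen k M : generated_by M k -> S (gen_local_cohomology a M X n).
  by move=> M [s sP]; apply: (gen (size s)); exists s.
elim: k M => [|k IHk] M [s [sk sP]].
  apply: (@serre_cyclic n M 0) => //; first exact: SR.
  move=> y; exists 0; rewrite scaler0; apply/esym/span_set0.
  have : y \in full M by [].
  by rewrite sP; case: s sk {sP} => // _; apply: span_subset.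
case: s sk sP => // x s [sk] sP.
pose U := span [set` s]%classic.
have fgM : finitely_generated M by exists (x :: s).
apply: (serre_middle noethR serreS (U := U) (g := quo_in U)) => //.
- exact: quo_in_surj.
- exact: quo_in_eq0.
- apply: (@serre_cyclic n _ (quo_in U x)) => //; first exact: SR.
  move=> z; have [y <-] := quo_in_surj z.
  have [|r yr] := @span_cons _ _ x s y; first by rewrite -sP.
  by exists r; rewrite -linearZ; apply/quo_in_eq; rewrite -opprB rpredN.
- by apply: IHk; rewrite -sk; apply: generated_subm.
Qed.

End MainInduction.

Theorem corollary2p9 (R : comNzRingType) (noethR : noetherian R) (a : ideal R)
    (S : lmodType R -> Prop) (serreS : serre_subcategory S)
    (X : lmodType R) (n : nat) :
  ((forall i : nat, (i <= n)%N -> S (local_cohomology a X i)) <->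
   (forall M : lmodType R, finitely_generated M ->
      forall i : nat, (i <= n)%N -> S (gen_local_cohomology a M X i))) /\
  ((forall i : nat, S (local_cohomology a X i)) <->
   (forall M : lmodType R, finitely_generated M ->
      forall i : nat, S (gen_local_cohomology a M X i))).
Proof.
have fgR := finitely_generated_ring R.
have [J <-] := coresolution_exists X.
split; split=> [SR M fgM i|SM i].
- move=> le_in; apply: serre_finitely_generated => // j ji.
  exact/SR/(leq_trans ji).
- exact: SM.
- exact: serre_finitely_generated.
- exact: SM.
Qed.
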